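(* Let $k\geq 4$ be an integer, put $$D(z)=(k-3)(k-1)^2(2k-3)-6(k-1)(2k-3)z^k-3(k-3)z^{2k},$$ and let $F=(F_1,F_2,F_3)$ be the meromorphic map from $\mathbb{CP}^1$ to $\mathbb C^3$ with components $$F_1(z)=\frac{-12\sqrt{-1}\,(k-3)(2k-3)z^2\,(2-3k+k^2-2z^k)}{4zD(z)},$$ $$F_2(z)=\frac{(k-1)\left(-12(3-2k)^2(k-2)z^k-12(k-3)(2k-3)z^{2k}+(k-3)\left((6-7k+2k^2)^2-12z^4\right)\right)}{4zD(z)},$$ $$F_3(z)=\frac{\sqrt{-1}\,(k-1)\left(12(3-2k)^2(k-2)z^k+12(k-3)(2k-3)z^{2k}+(k-3)\left(-(6-7k+2k^2)^2-12z^4\right)\right)}{4zD(z)}.$$ Then the real part $f=\Re(F)$, defined on the complement in $\mathbb{CP}^1$ of the set of poles of $F$ and taking values in $\mathbb R^3$, is a (genus $0$) minimal surface in $\mathbb R^3$ with $2k+1$ embedded planar ends.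
   Context: A minimal surface with embedded planar ends is defined as follows. Let $\hat\Sigma$ be a compact Riemann surface and $\phi\colon\hat\Sigma\to S^3$ a smooth, conformally parametrised immersion such that, for some point $p\in S^3$ with stereographic projection $\pi_p\colon S^3\setminus\{p\}\to\mathbb R^3$, the composition $f=\pi_p\circ\phi\colon \Sigma=\hat\Sigma\setminus\phi^{-1}(\{p\})\to\mathbb R^3$ is a (conformally immersed) minimal surface in $\mathbb R^3$. Then $f$ is called a minimal surface with embedded planar ends; its ends are the points of $\phi^{-1}(\{p\})$, and the number of ends is the number of these points. The genus of $f$ is the genus of $\hat\Sigma$, here $\hat\Sigma=\mathbb{CP}^1=\mathbb C\cup\{\infty\}$ with affine coordinate $z$. *)

(* Defs.v *)
From HB Require Import structures.
From mathcomp Require Import all_boot all_order all_algebra.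
From mathcomp Require Import all_classical all_reals all_analysis.
From mathcomp Require Import complex.

Set Implicit Arguments.
Unset Strict Implicit.
Unset Printing Implicit Defensive.

Import Order.TTheory GRing.Theory Num.Theory.
Import numFieldNormedType.Exports.
Import ComplexField.

Local Open Scope classical_set_scope.
Local Open Scope ring_scope.
Local Open Scope complex_scope.

Definition dotv (R : realType) (n : nat) (u v : 'rV[R]_n) : R :=
  \sum_i u 0 i * v 0 i.

Definition crossv (R : realType) (u v : 'rV[R]_3) : 'rV[R]_3 :=
  \row_(j < 3) (u 0 (ordS j) * v 0 (ord_pred j) - u 0 (ord_pred j) * v 0 (ordS j)).

(* Parametrised surface patches are total functions on the plane 'rV_2; only
   their germs at the points of interest matter. *)

Definition partial (R : realType) (n : nat) (i : 'I_2)
    (X : 'rV[R]_2 -> 'rV[R]_n.+1) : 'rV[R]_2 -> 'rV[R]_n.+1 :=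
  'D_(delta_mx 0 i) X.

Definition partials (R : realType) (n : nat) (s : seq 'I_2)
    (X : 'rV[R]_2 -> 'rV[R]_n.+1) : 'rV[R]_2 -> 'rV[R]_n.+1 :=
  foldr (@partial R n) X s.

(* Meant for open U. *)
Definition smooth_on (R : realType) (n : nat) (U : set 'rV[R]_2)
    (X : 'rV[R]_2 -> 'rV[R]_n.+1) : Prop :=
  forall (s : seq 'I_2) (u : 'rV[R]_2), U u ->
    {for u, continuous (partials s X)} /\
    forall i : 'I_2, derivable (partials s X) u (delta_mx 0 i).

Definition fund1 (R : realType) (n : nat) (X : 'rV[R]_2 -> 'rV[R]_n.+1)
    (u : 'rV[R]_2) : 'M[R]_2 :=
  \matrix_(i, j) dotv (partial i X u) (partial j X u).

Definition conformal_immersion_on (R : realType) (n : nat) (U : set 'rV[R]_2)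
    (X : 'rV[R]_2 -> 'rV[R]_n.+1) : Prop :=
  smooth_on U X /\
  forall u, U u -> exists2 lambda : R, 0 < lambda & fund1 X u = lambda%:M.

Definition unit_normal (R : realType) (X : 'rV[R]_2 -> 'rV[R]_3)
    (u : 'rV[R]_2) : 'rV[R]_3 :=
  let N := crossv (partial 0 X u) (partial 1 X u) in
  (Num.sqrt (dotv N N))^-1 *: N.

Definition fund2 (R : realType) (X : 'rV[R]_2 -> 'rV[R]_3)
    (u : 'rV[R]_2) : 'M[R]_2 :=
  \matrix_(i, j) dotv (partial i (partial j X) u) (unit_normal X u).

(* Half the trace of the shape operator. *)
Definition mean_curvature (R : realType) (X : 'rV[R]_2 -> 'rV[R]_3)
    (u : 'rV[R]_2) : R :=
  \tr (invmx (fund1 X u) *m fund2 X u) / 2.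

Definition CP1 (R : realType) : Type := one_point_compactification R[i]^o.

(* The charts z |-> z (inf = false) and w |-> 1/w (inf = true), in the real
   coordinates of the complex parameter. *)
Definition CP1_chart (R : realType) (inf : bool) (u : 'rV[R]_2) : CP1 R :=
  let z := u 0 0 +i* u 0 1 in
  if inf then (if z == 0 then None else Some z^-1) else Some z.

Definition CP1_conformal_immersion_on (R : realType) (n : nat)
    (S : set (CP1 R)) (f : CP1 R -> 'rV[R]_n.+1) : Prop :=
  forall inf : bool,
    conformal_immersion_on (@CP1_chart R inf @^-1` S) (f \o @CP1_chart R inf).

Definition CP1_minimal_surface_on (R : realType) (S : set (CP1 R))
    (f : CP1 R -> 'rV[R]_3) : Prop :=
  CP1_conformal_immersion_on S f /\
  forall (inf : bool) (u : 'rV[R]_2), S (CP1_chart inf u) ->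
    mean_curvature (f \o @CP1_chart R inf) u = 0.

Definition sphere3 (R : realType) : set 'rV[R]_4 := [set x | dotv x x = 1].

(* Stereographic projection from p onto the hyperplane orthogonal to p, which
   is identified with R^3 by the orthonormal basis given by the columns of B. *)
Definition stereo_frame (R : realType) (p : 'rV[R]_4) (B : 'M[R]_(4, 3)) : Prop :=
  B^T *m B = 1%:M /\ p *m B = 0.

Definition stereo (R : realType) (p : 'rV[R]_4) (B : 'M[R]_(4, 3))
    (x : 'rV[R]_4) : 'rV[R]_3 :=
  (1 - dotv x p)^-1 *: (x *m B).

(* f is a genus 0 minimal surface with embedded planar ends, the ends being the
   points of E; the values of f on E are irrelevant. *)
Definition minimal_surface_planar_ends (R : realType) (E : set (CP1 R))
    (f : CP1 R -> 'rV[R]_3) : Prop :=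
  exists (phi : CP1 R -> 'rV[R]_4) (p : 'rV[R]_4) (B : 'M[R]_(4, 3)),
    [/\ (forall a, sphere3 (phi a)),
        CP1_conformal_immersion_on setT phi,
        sphere3 p /\ stereo_frame p B,
        phi @^-1` [set p] = E &
        (forall a, ~ E a -> f a = stereo p B (phi a)) /\
        CP1_minimal_surface_on (~` E) f].

(* A meromorphic function on CP1 is represented by a function g on the affine
   line, of which the values at finitely many points are irrelevant.
   CP1_dnbhs a is the filter of its affine variable tending to a, a excluded. *)
Definition CP1_dnbhs (R : realType) (a : CP1 R) : set_system R[i] :=
  match a with
  | Some z0 => (z0 : R[i]^o)^'
  | None => w^-1 @[w --> (0 : R[i]^o)^']
  end.

Definition is_pole (R : realType) (g : R[i] -> R[i]) (a : CP1 R) : Prop :=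
  forall M : R, \forall z \near CP1_dnbhs a, M%:C < `|g z|.

Definition mero_value (R : realType) (g : R[i] -> R[i]) (a : CP1 R) : R[i] :=
  lim ((g z : R[i]^o) @[z --> CP1_dnbhs a]).

Definition poles (R : realType) (n : nat) (F : R[i] -> 'rV[R[i]]_n) : set (CP1 R) :=
  [set a | exists j : 'I_n, is_pole (fun z => F z 0 j) a].

(* Meaningful off the poles of F. *)
Definition mero_Re (R : realType) (n : nat) (F : R[i] -> 'rV[R[i]]_n)
    (a : CP1 R) : 'rV[R]_n :=
  \row_j complex.Re (mero_value (fun z => F z 0 j) a).

Definition polyD (R : realType) (k : nat) (z : R[i]) : R[i] :=
  (k%:R - 3) * (k%:R - 1) ^+ 2 * (2 * k%:R - 3)
  - 6 * (k%:R - 1) * (2 * k%:R - 3) * z ^+ k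
  - 3 * (k%:R - 3) * z ^+ (2 * k).

Definition mapF1 (R : realType) (k : nat) (z : R[i]) : R[i] :=
  (- 12 * 'i * (k%:R - 3) * (2 * k%:R - 3) * z ^+ 2
     * (2 - 3 * k%:R + k%:R ^+ 2 - 2 * z ^+ k))
  / (4 * z * polyD k z).

Definition mapF2 (R : realType) (k : nat) (z : R[i]) : R[i] :=
  ((k%:R - 1) *
     (- 12 * (3 - 2 * k%:R) ^+ 2 * (k%:R - 2) * z ^+ k
      - 12 * (k%:R - 3) * (2 * k%:R - 3) * z ^+ (2 * k)
      + (k%:R - 3) * ((6 - 7 * k%:R + 2 * k%:R ^+ 2) ^+ 2 - 12 * z ^+ 4)))
  / (4 * z * polyD k z).

Definition mapF3 (R : realType) (k : nat) (z : R[i]) : R[i] :=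
  ('i * (k%:R - 1) *
     (12 * (3 - 2 * k%:R) ^+ 2 * (k%:R - 2) * z ^+ k
      + 12 * (k%:R - 3) * (2 * k%:R - 3) * z ^+ (2 * k)
      + (k%:R - 3) * (- (6 - 7 * k%:R + 2 * k%:R ^+ 2) ^+ 2 - 12 * z ^+ 4)))
  / (4 * z * polyD k z).

Definition mapF (R : realType) (k : nat) (z : R[i]) : 'rV[R[i]]_3 :=
  \row_(j < 3) [:: mapF1 k z; mapF2 k z; mapF3 k z]`_j.

(* Main.v *)
(** A null curve [N / q] in C^3 with polynomial [N] and [q], such that [N . N = q m]
    and [N' . N' = q' m'], is the light-like curve [(N, q, m)] of C^5.  Putting
      [v = 2 Re (N q^* )],  [k = |q|^2],  [g = Re (m q^* ) / 2 + |N|^2 / 2],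
    one has [|v|^2 + (g - k)^2 = (g + k)^2], and inverse stereographic projection of the
    minimal surface [Re (N / q) = v / (2 k)] is [(v, g - k) / (g + k)].  This map is
    smooth across the zeros of [q], and its metric is the polynomial expression
    [2 |N' q - N q'|^2 / (g + k)^2] times the identity; hence it is a conformal
    immersion as soon as [N' q - N q'] has no zero.  The same applies at infinity,
    after multiplying [(N, q, m)(1/w)] by [w^(2k+1)], which does not change the
    projection.

    For the given curve [q = 4 z D] and [m] is a multiple of [z^3].  The combination
    [N_2 - i N_3] is a multiple of [z^4], so that the corresponding component of
    [N' q - N q'] is a multiple of [z^4 (z^k + k - 1)^2], and at its zeros another
    component does not vanish.  At a zero of [q] the vector [N' q - N q'] is [- N q'],
    so the zeros of [q] are simple poles, and there are [2k+1 = deg q] of them. *)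

Require Import Defs.
From HB Require Import structures.
From mathcomp Require Import all_boot all_order all_algebra.
From mathcomp Require Import all_classical all_reals all_analysis.
From mathcomp Require Import complex ring finmap zify.

Set Implicit Arguments.
Unset Strict Implicit.
Unset Printing Implicit Defensive.

Import Order.TTheory GRing.Theory Num.Theory.
Import numFieldNormedType.Exports.
Import ComplexField.

Local Open Scope classical_set_scope.
Local Open Scope ring_scope.
Local Open Scope complex_scope.

Local Notation Re := complex.Re.
Local Notation Im := complex.Im.

(** * Partial derivatives of rational expressions in z and its conjugate *)

Definition plane_point (R : realType) (u : 'rV[R]_2) : R[i] := u 0 0 +i* u 0 1.

(** Real and imaginary parts are differentiated separately: the derivative is along a real
    direction, and functions such as conjugates are not holomorphic. *)
Definition is_cderive (R : realType) (u v : 'rV[R]_2) (g : 'rV[R]_2 -> R[i])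
    (c : R[i]) : Prop :=
  is_derive u v (fun x => Re (g x)) (Re c) /\
  is_derive u v (fun x => Im (g x)) (Im c).

Definition ccontinuous_at (R : realType) (u : 'rV[R]_2) (g : 'rV[R]_2 -> R[i]) : Prop :=
  {for u, continuous (fun x => Re (g x))} /\
  {for u, continuous (fun x => Im (g x))}.

Lemma complexReD (R : realType) (a b : R[i]) : Re (a + b) = Re a + Re b.
Proof. by case: a b => [? ?] [? ?]. Qed.

Lemma complexImD (R : realType) (a b : R[i]) : Im (a + b) = Im a + Im b.
Proof. by case: a b => [? ?] [? ?]. Qed.

Lemma complexReM (R : realType) (a b : R[i]) : Re (a * b) = Re a * Re b - Im a * Im b.
Proof. by case: a b => [? ?] [? ?]. Qed.

Lemma complexImM (R : realType) (a b : R[i]) : Im (a * b) = Re a * Im b + Im a * Re b.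
Proof. by case: a b => [? ?] [? ?]. Qed.

Lemma complexReJ (R : realType) (a : R[i]) : Re a^* = Re a.
Proof. by case: a. Qed.

Lemma complexImJ (R : realType) (a : R[i]) : Im a^* = - Im a.
Proof. by case: a. Qed.

Lemma complexReV (R : realType) (a : R[i]) : Re a^-1 = Re a / (Re a ^+ 2 + Im a ^+ 2).
Proof. by case: a. Qed.

Lemma complexImV (R : realType) (a : R[i]) : Im a^-1 = - (Im a / (Re a ^+ 2 + Im a ^+ 2)).
Proof. by case: a. Qed.

Lemma normsq_neq0 (R : realType) (a : R[i]) : a != 0 -> Re a ^+ 2 + Im a ^+ 2 != 0.
Proof.
case: a => a b; rewrite eq_complex /=.
by rewrite paddr_eq0 ?sqr_ge0 // !sqrf_eq0.
Qed.

Lemma is_cderive_cst (R : realType) (u v : 'rV[R]_2) (c : R[i]) :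
  is_cderive u v (fun=> c) 0.
Proof. by split; exact: is_derive_cst. Qed.

Lemma is_cderiveD (R : realType) (u v : 'rV[R]_2) (f g : 'rV[R]_2 -> R[i]) (a b : R[i]) :
  is_cderive u v f a -> is_cderive u v g b -> is_cderive u v (fun x => f x + g x) (a + b).
Proof.
move=> [fr fi] [gr gi]; split.
- rewrite complexReD (_ : (fun x => _) = (fun x => Re (f x)) + (fun x => Re (g x))).
    exact: is_deriveD.
  by apply/funext => x; rewrite complexReD.
- rewrite complexImD (_ : (fun x => _) = (fun x => Im (f x)) + (fun x => Im (g x))).
    exact: is_deriveD.
  by apply/funext => x; rewrite complexImD.
Qed.

Lemma is_cderiveM (R : realType) (u v : 'rV[R]_2) (f g : 'rV[R]_2 -> R[i]) (a b : R[i]) :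
  is_cderive u v f a -> is_cderive u v g b ->
  is_cderive u v (fun x => f x * g x) (a * g u + f u * b).
Proof.
move=> [fr fi] [gr gi]; split.
- rewrite (_ : (fun x => _) = (fun x => Re (f x)) * (fun x => Re (g x))
     - (fun x => Im (f x)) * (fun x => Im (g x))); last first.
    by apply/funext => x; rewrite complexReM.
  apply: is_derive_eq; rewrite /GRing.scale /= !(complexReD, complexReM); ring.
- rewrite (_ : (fun x => _) = (fun x => Re (f x)) * (fun x => Im (g x))
     + (fun x => Im (f x)) * (fun x => Re (g x))); last first.
    by apply/funext => x; rewrite complexImM.
  apply: is_derive_eq; rewrite /GRing.scale /= !(complexImD, complexImM); ring.
Qed.

Lemma is_cderiveC (R : realType) (u v : 'rV[R]_2) (f : 'rV[R]_2 -> R[i]) (a : R[i]) :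
  is_cderive u v f a -> is_cderive u v (fun x => (f x)^*) a^*.
Proof.
move=> [fr fi]; split.
- by rewrite complexReJ (_ : (fun x => _) = (fun x => Re (f x))) //; apply/funext => x; rewrite complexReJ.
- rewrite complexImJ (_ : (fun x => _) = - (fun x => Im (f x))); first exact: is_deriveN.
  by apply/funext => x; rewrite complexImJ.
Qed.

Lemma is_cderiveV (R : realType) (u v : 'rV[R]_2) (f : 'rV[R]_2 -> R[i]) (a : R[i]) :
  f u != 0 -> is_cderive u v f a -> is_cderive u v (fun x => (f x)^-1) (- (a / f u ^+ 2)).
Proof.
move=> fu0 [fr fi].
have n0 := normsq_neq0 fu0.
have hN : is_derive u v (fun x => (Re (f x) ^+ 2 + Im (f x) ^+ 2)^-1)
   (- (Re (f u) ^+ 2 + Im (f u) ^+ 2) ^- 2 * (2 * Re (f u) * Re a + 2 * Im (f u) * Im a)).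
  have h : is_derive u v (fun x => Re (f x) ^+ 2 + Im (f x) ^+ 2)
     (2 * Re (f u) * Re a + 2 * Im (f u) * Im a).
    rewrite (_ : (fun x => _) = (fun x => Re (f x)) * (fun x => Re (f x))
     + (fun x => Im (f x)) * (fun x => Im (f x))); last first.
      by apply/funext => x; rewrite !expr2.
    apply: is_derive_eq; rewrite /GRing.scale /=; ring.
  apply: DeriveDef; first by apply: derivableV => //; exact: ex_derive.
  by rewrite deriveV //; rewrite derive_val.
have e : - (a / f u ^+ 2) = - a * ((f u)^-1 * (f u)^-1) by rewrite expr2 invfM mulNr.
rewrite e; split.
- rewrite (_ : (fun x => _) = (fun x => Re (f x)) *
     (fun x => (Re (f x) ^+ 2 + Im (f x) ^+ 2)^-1)); last first.
    by apply/funext => x; rewrite complexReV.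
  apply: is_derive_eq; rewrite /GRing.scale /=.
  rewrite !(complexReM, complexImM, complexReV, complexImV) !raddfN /=; field.
  by rewrite n0.
- rewrite (_ : (fun x => _) = - ((fun x => Im (f x)) *
     (fun x => (Re (f x) ^+ 2 + Im (f x) ^+ 2)^-1))); last first.
    by apply/funext => x; rewrite complexImV.
  apply: is_derive_eq; rewrite /GRing.scale /=.
  rewrite !(complexReM, complexImM, complexReV, complexImV) !raddfN /=; field.
  by rewrite n0.
Qed.

Lemma is_cderive_plane_point (R : realType) (u v : 'rV[R]_2) :
  is_cderive u v (@plane_point R) (plane_point v).
Proof.
have h (i : 'I_2) : is_derive u v (fun x : 'rV[R]_2 => x 0 i) (v 0 i).
  have := @derivable_id R 'rV[R]_2 u v; move=> /[dup] d.
  move/derivable_mxP => /(_ 0 i) di; apply: DeriveDef => //.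
  have := derive_mx d; rewrite derive_id => /matrixP/(_ 0 i).
  by rewrite mxE.
by split; exact: h.
Qed.

Lemma is_cderive_horner (R : realType) (u v : 'rV[R]_2) (p : {poly R[i]}) :
  is_cderive u v (fun x => p.[plane_point x]) (plane_point v * p^`().[plane_point u]).
Proof.
elim/poly_ind: p => [|p c ih].
  rewrite deriv0 horner0 mulr0 (_ : (fun x => _) = fun=> 0); first exact: is_cderive_cst.
  by apply/funext => x; rewrite horner0.
rewrite (_ : (fun x => _) = fun x => p.[plane_point x] * plane_point x + c); last first.
  by apply/funext => x; rewrite hornerMXaddC.
rewrite derivMXaddC !hornerE.
have -> : plane_point v * (p.[plane_point u] + p^`().[plane_point u] * plane_point u) =
  (plane_point v * p^`().[plane_point u] * plane_point u + p.[plane_point u] * plane_point v) + 0 by ring.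
apply: is_cderiveD; last exact: is_cderive_cst.
by apply: is_cderiveM => //; exact: is_cderive_plane_point.
Qed.

Lemma ccontinuous_cst (R : realType) (u : 'rV[R]_2) (c : R[i]) :
  ccontinuous_at u (fun=> c).
Proof. by split; exact: cst_continuous. Qed.

Lemma ccontinuousD (R : realType) (u : 'rV[R]_2) (f g : 'rV[R]_2 -> R[i]) :
  ccontinuous_at u f -> ccontinuous_at u g -> ccontinuous_at u (fun x => f x + g x).
Proof.
move=> [fr fi] [gr gi]; split.
- rewrite (_ : (fun x => _) = (fun x => Re (f x)) + (fun x => Re (g x))).
    exact: continuousD.
  by apply/funext => x; rewrite complexReD.
- rewrite (_ : (fun x => _) = (fun x => Im (f x)) + (fun x => Im (g x))).
    exact: continuousD.
  by apply/funext => x; rewrite complexImD.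
Qed.

Lemma ccontinuousM (R : realType) (u : 'rV[R]_2) (f g : 'rV[R]_2 -> R[i]) :
  ccontinuous_at u f -> ccontinuous_at u g -> ccontinuous_at u (fun x => f x * g x).
Proof.
move=> [fr fi] [gr gi]; split.
- rewrite (_ : (fun x => _) = (fun x => Re (f x)) * (fun x => Re (g x))
     - (fun x => Im (f x)) * (fun x => Im (g x))).
    by apply: continuousB; exact: continuousM.
  by apply/funext => x; rewrite complexReM.
- rewrite (_ : (fun x => _) = (fun x => Re (f x)) * (fun x => Im (g x))
     + (fun x => Im (f x)) * (fun x => Re (g x))).
    by apply: continuousD; exact: continuousM.
  by apply/funext => x; rewrite complexImM.
Qed.

Lemma ccontinuousC (R : realType) (u : 'rV[R]_2) (f : 'rV[R]_2 -> R[i]) :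
  ccontinuous_at u f -> ccontinuous_at u (fun x => (f x)^*).
Proof.
move=> [fr fi]; split.
- by rewrite (_ : (fun x => _) = (fun x => Re (f x))) //; apply/funext => x; rewrite complexReJ.
- rewrite (_ : (fun x => _) = - (fun x => Im (f x))); first exact: continuousN.
  by apply/funext => x; rewrite complexImJ.
Qed.

Lemma ccontinuousV (R : realType) (u : 'rV[R]_2) (f : 'rV[R]_2 -> R[i]) :
  f u != 0 -> ccontinuous_at u f -> ccontinuous_at u (fun x => (f x)^-1).
Proof.
move=> fu0 [fr fi].
have n0 := normsq_neq0 fu0.
have hN : {for u, continuous (fun x => (Re (f x) ^+ 2 + Im (f x) ^+ 2)^-1)}.
  apply: continuousV => //.
  rewrite (_ : (fun x => _) = (fun x => Re (f x)) * (fun x => Re (f x))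
     + (fun x => Im (f x)) * (fun x => Im (f x))).
    by apply: continuousD; exact: continuousM.
  by apply/funext => x; rewrite !expr2.
split.
- rewrite (_ : (fun x => _) = (fun x => Re (f x)) *
     (fun x => (Re (f x) ^+ 2 + Im (f x) ^+ 2)^-1)).
    exact: continuousM.
  by apply/funext => x; rewrite complexReV.
- rewrite (_ : (fun x => _) = - ((fun x => Im (f x)) *
     (fun x => (Re (f x) ^+ 2 + Im (f x) ^+ 2)^-1))).
    by apply: continuousN; exact: continuousM.
  by apply/funext => x; rewrite complexImV.
Qed.

Lemma ccontinuous_horner (R : realType) (u : 'rV[R]_2) (p : {poly R[i]}) :
  ccontinuous_at u (fun x => p.[plane_point x]).
Proof.
elim/poly_ind: p => [|p c ih].
  rewrite (_ : (fun x => _) = fun=> 0); first exact: ccontinuous_cst.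
  by apply/funext => x; rewrite horner0.
rewrite (_ : (fun x => _) = fun x => p.[plane_point x] * plane_point x + c); last first.
  by apply/funext => x; rewrite hornerMXaddC.
apply: ccontinuousD; last exact: ccontinuous_cst.
apply: ccontinuousM => //.
by split; exact: coord_continuous.
Qed.

(* Rational expressions in holomorphic polynomials and their conjugates: a class
   of functions of z and its conjugate that is closed under partial derivatives. *)
Inductive wexp (R : realType) : Type :=
| WHol of {poly R[i]}
| WConj of wexp R
| WAdd of wexp R & wexp R
| WMul of wexp R & wexp R
| WInv of wexp R.

Fixpoint weval (R : realType) (e : wexp R) (z : R[i]) : R[i] :=
  match e with
  | WHol p => p.[z]
  | WConj e => (weval e z)^*
  | WAdd e f => weval e z + weval f z
  | WMul e f => weval e z * weval f z
  | WInv e => (weval e z)^-1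
  end.

(** Inversion sends 0 to 0, so [weval] is total; [wdom] holds where no inverse is taken at 0 and the
    differentiation rules apply. *)
Fixpoint wdom (R : realType) (e : wexp R) (z : R[i]) : bool :=
  match e with
  | WHol p => true
  | WConj e => wdom e z
  | WAdd e f => wdom e z && wdom f z
  | WMul e f => wdom e z && wdom f z
  | WInv e => wdom e z && (weval e z != 0)
  end.

(* The derivative in the real direction t of the plane. *)
Fixpoint wdiff (R : realType) (t : R[i]) (e : wexp R) : wexp R :=
  match e with
  | WHol p => WHol (t *: p^`())
  | WConj e => WConj (wdiff t e)
  | WAdd e f => WAdd (wdiff t e) (wdiff t f)
  | WMul e f => WAdd (WMul (wdiff t e) f) (WMul e (wdiff t f))
  | WInv e => WMul (WHol (-1)%:P) (WMul (wdiff t e) (WInv (WMul e e)))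
  end.

(** The derivative inverts only the square of an expression that was already inverted, so no new
    singularity appears and differentiation can be iterated. *)
Lemma wdom_wdiff (R : realType) (t : R[i]) (e : wexp R) (z : R[i]) :
  wdom e z -> wdom (wdiff t e) z.
Proof.
elim: e => //= [e he f hf|e he f hf|e he].
- by move=> /andP[/he -> /hf ->].
- by move=> /andP[/[dup] /he -> -> /[dup] /hf -> ->].
- by move=> /andP[/[dup] /he -> ->] e0 /=; rewrite mulf_neq0.
Qed.

Lemma is_cderive_weval (R : realType) (u v : 'rV[R]_2) (e : wexp R) :
  wdom e (plane_point u) ->
  is_cderive u v (fun x => weval e (plane_point x)) (weval (wdiff (plane_point v) e) (plane_point u)).
Proof.
elim: e => /= [p _|e he /he|e he f hf /andP[/he {}he /hf {}hf]
  |e he f hf /andP[/he {}he /hf {}hf]|e he /andP[/he {}he e0]].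
- by rewrite hornerZ; exact: is_cderive_horner.
- exact: is_cderiveC.
- exact: is_cderiveD.
- exact: is_cderiveM.
- by rewrite hornerC mulN1r -expr2; exact: is_cderiveV.
Qed.

Lemma ccontinuous_weval (R : realType) (u : 'rV[R]_2) (e : wexp R) :
  wdom e (plane_point u) -> ccontinuous_at u (fun x => weval e (plane_point x)).
Proof.
elim: e => /= [p _|e he /he|e he f hf /andP[/he {}he /hf {}hf]
  |e he f hf /andP[/he {}he /hf {}hf]|e he /andP[/he {}he e0]].
- exact: ccontinuous_horner.
- exact: ccontinuousC.
- exact: ccontinuousD.
- exact: ccontinuousM.
- exact: ccontinuousV.
Qed.

Definition wpartials (R : realType) (s : seq 'I_2) (e : wexp R) : wexp R :=
  foldr (fun i => wdiff (plane_point (delta_mx 0 i))) e s.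

Lemma wdom_wpartials (R : realType) (s : seq 'I_2) (e : wexp R) (z : R[i]) :
  wdom e z -> wdom (wpartials s e) z.
Proof. by move=> h; elim: s => //= i s; exact: wdom_wdiff. Qed.

Lemma derive_row_weval (R : realType) (n : nat) (e : 'I_n.+1 -> wexp R)
    (u v : 'rV[R]_2) :
  (forall j, wdom (e j) (plane_point u)) ->
  is_derive u v (fun x => \row_j Re (weval (e j) (plane_point x)) : 'rV[R]_n.+1)
    (\row_j Re (weval (wdiff (plane_point v) (e j)) (plane_point u))).
Proof.
move=> edom.
have d : derivable (fun x => \row_j Re (weval (e j) (plane_point x)) : 'rV[R]_n.+1) u v.
  apply/derivable_mxP => i j; under eq_fun do rewrite mxE.
  have [h _] := @is_cderive_weval R u v _ (edom j); exact: ex_derive.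
apply: DeriveDef => //; rewrite derive_mx //; apply/matrixP => i j; rewrite !mxE.
under eq_fun do rewrite mxE.
have [h _] := @is_cderive_weval R u v _ (edom j); exact: derive_val.
Qed.

Lemma continuous_row_weval (R : realType) (n : nat) (e : 'I_n.+1 -> wexp R)
    (u : 'rV[R]_2) :
  (forall j, wdom (e j) (plane_point u)) ->
  {for u, continuous (fun x => \row_j Re (weval (e j) (plane_point x)) : 'rV[R]_n.+1)}.
Proof.
move=> edom; have FF : Filter (nbhs u) by exact: nbhs_filter.
apply/cvgrPdist_le => r r0.
have h : \forall x \near u, forall j : 'I_n.+1,
    `|Re (weval (e j) (plane_point u)) - Re (weval (e j) (plane_point x))| <= r.
  apply: (@filter_forall _ _ (fun j x => `|Re (weval (e j) (plane_point u)) - Re (weval (e j) (plane_point x))| <= r)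
    (nbhs u) FF) => j.
  have [h _] := ccontinuous_weval (edom j).
  by move/cvgrPdist_le: h; apply.
near=> x; rewrite [leLHS]/Num.Def.normr /= mx_normrE (bigmax_le _ (ltW r0)) //= => ij _.
by rewrite !mxE; move: ij.2; near: x.
Unshelve. all: by end_near. Qed.

(** Since [U] is open, the formula for one order holds near each point of [U]; a derivative depends
    only on the germ, so the next order follows. *)
Lemma partials_weval (R : realType) (n : nat) (U : set 'rV[R]_2)
    (X : 'rV[R]_2 -> 'rV[R]_n.+1) (e : 'I_n.+1 -> wexp R) (s : seq 'I_2) :
  open U ->
  (forall u, U u -> forall j, wdom (e j) (plane_point u)) ->
  (forall u, U u -> X u = \row_j Re (weval (e j) (plane_point u))) ->
  forall u, U u ->
    partials s X u = \row_j Re (weval (wpartials s (e j)) (plane_point u)).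
Proof.
move=> oU edom XE; elim: s => [|i s ih] u Uu /=; first exact: XE.
have dom : forall j, wdom (wpartials s (e j)) (plane_point u).
  by move=> j; apply: wdom_wpartials; exact: edom.
have := @derive_row_weval R n _ u (delta_mx 0 i) dom => h.
rewrite -[RHS](@derive_val _ _ _ _ _ _ _ h); apply: near_eq_derive.
have := open_nbhs_nbhs (conj oU Uu); apply: filterS => x Ux.
exact: ih.
Qed.

Lemma smooth_on_weval (R : realType) (n : nat) (U : set 'rV[R]_2)
    (X : 'rV[R]_2 -> 'rV[R]_n.+1) (e : 'I_n.+1 -> wexp R) :
  open U ->
  (forall u, U u -> forall j, wdom (e j) (plane_point u)) ->
  (forall u, U u -> X u = \row_j Re (weval (e j) (plane_point u))) ->
  smooth_on U X.
Proof.
move=> oU edom XE s u Uu.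
have dom : forall j, wdom (wpartials s (e j)) (plane_point u).
  by move=> j; apply: wdom_wpartials; exact: edom.
have near_eq : \forall x \near u,
    \row_j Re (weval (wpartials s (e j)) (plane_point x)) = partials s X x.
  have := open_nbhs_nbhs (conj oU Uu); apply: filterS => x Ux.
  by rewrite (partials_weval s oU edom XE).
split.
- have := continuous_row_weval dom; rewrite /prop_for /continuous_at.
  rewrite (partials_weval s oU edom XE) //.
  move=> h; apply: cvg_trans h.
  apply: (@near_eq_cvg _ _ (nbhs u)).
  exact: near_eq.
- move=> i; have := @derive_row_weval R n _ u (delta_mx 0 i) dom => h.
  by have [] := near_eq_is_derive near_eq h.
Qed.

(** * The metric of a light-like map and of its projection to the sphere *)

(** Expanding [v / s] by the quotient rule, the relations [|v| = s] and its derivatives cancel all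
    terms in [ds] and [ds']. Projectivising a light-like [(v, s)] thus only rescales its Lorentzian
    metric [L] by [1 / s ^+ 2]. *)
Lemma projectivised_metric (F : fieldType) (s ds ds' L : F) (v dv dv' : 'I_4 -> F) :
  s != 0 ->
  \sum_l v l ^+ 2 = s ^+ 2 ->
  \sum_l v l * dv l = s * ds ->
  \sum_l v l * dv' l = s * ds' ->
  \sum_l dv l * dv' l = ds * ds' + L ->
  \sum_l (dv l / s - v l * ds / s ^+ 2) * (dv' l / s - v l * ds' / s ^+ 2) =
    L / s ^+ 2.
Proof.
move=> s0 Hv Ha Hb Hab.
transitivity ((\sum_l dv l * dv' l) / s ^+ 2 - ds' / s ^+ 3 * (\sum_l v l * dv l)
  - ds / s ^+ 3 * (\sum_l v l * dv' l) + ds * ds' / s ^+ 4 * (\sum_l v l ^+ 2)).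
  rewrite mulr_suml !mulr_sumr -!sumrB -big_split /=.
  by apply: eq_bigr => l _; field; rewrite s0.
by rewrite Hv Ha Hb Hab; field; rewrite s0.
Qed.

(* The polynomial identities behind conformality.  [n, q, m] are the values of
   polynomials with [n . n = q m] and [n' . n' = q' m'], [d, dq, dm] those of
   their derivatives, and the suffix b marks complex conjugates.  The lift
   [(n qb + nb q, g - q qb, g + q qb)] then lies on the light cone. *)
Section LightCone.
Variables (F : numFieldType) (n0 n1 n2 nb0 nb1 nb2 d0 d1 d2 db0 db1 db2 : F).
Variables (q qb m mb dq dqb dm dmb : F).

Hypothesis E1 : n0 ^+ 2 + n1 ^+ 2 + n2 ^+ 2 - q * m = 0.
Hypothesis E2 : n0 * d0 + n1 * d1 + n2 * d2 - (q * dm + dq * m) / 2 = 0.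
Hypothesis E3 : d0 ^+ 2 + d1 ^+ 2 + d2 ^+ 2 - dq * dm = 0.
Hypothesis E1b : nb0 ^+ 2 + nb1 ^+ 2 + nb2 ^+ 2 - qb * mb = 0.
Hypothesis E2b : nb0 * db0 + nb1 * db1 + nb2 * db2 - (qb * dmb + dqb * mb) / 2 = 0.
Hypothesis E3b : db0 ^+ 2 + db1 ^+ 2 + db2 ^+ 2 - dqb * dmb = 0.

Let v n nb := n * qb + nb * q.
(** The product rule along the real direction [t] with conjugate [tb]: holomorphic factors
    contribute [t], conjugated ones [tb]. *)
Let dv t tb n nb d db := t * d * qb + n * (tb * dqb) + (tb * db * q + nb * (t * dq)).
Let g := (m * qb + mb * q) / 4 + (n0 * nb0 + n1 * nb1 + n2 * nb2) / 2.
Let dg t tb := (t * dm * qb + m * (tb * dqb) + (tb * dmb * q + mb * (t * dq))) / 4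
  + (t * d0 * nb0 + n0 * (tb * db0) + (t * d1 * nb1 + n1 * (tb * db1))
     + (t * d2 * nb2 + n2 * (tb * db2))) / 2.
Let k := q * qb.
Let dk t tb := t * dq * qb + q * (tb * dqb).

(** As [(g + k)^2 - (g - k)^2 = 4 g k], the mixed terms [n . nb] cancel and only the nullity
    relation and its conjugate remain. *)
Lemma light_cone :
  v n0 nb0 ^+ 2 + v n1 nb1 ^+ 2 + v n2 nb2 ^+ 2 + (g - k) ^+ 2 = (g + k) ^+ 2.
Proof.
apply/eqP; rewrite -subr_eq0; apply/eqP.
transitivity (qb ^+ 2 * (n0 ^+ 2 + n1 ^+ 2 + n2 ^+ 2 - q * m)
  + q ^+ 2 * (nb0 ^+ 2 + nb1 ^+ 2 + nb2 ^+ 2 - qb * mb)); last first.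
  by rewrite E1 E1b !mulr0 addr0.
by rewrite /v /g /k; field.
Qed.

(** Half the derivative of [light_cone]; [E2] is itself half the derivative of [E1]. *)
Lemma light_cone_tangent t tb :
  v n0 nb0 * dv t tb n0 nb0 d0 db0 + v n1 nb1 * dv t tb n1 nb1 d1 db1
    + v n2 nb2 * dv t tb n2 nb2 d2 db2 + (g - k) * (dg t tb - dk t tb)
  = (g + k) * (dg t tb + dk t tb).
Proof.
apply/eqP; rewrite -subr_eq0; apply/eqP.
transitivity (qb * (tb * dqb) * (n0 ^+ 2 + n1 ^+ 2 + n2 ^+ 2 - q * m)
  + qb ^+ 2 * t * (n0 * d0 + n1 * d1 + n2 * d2 - (q * dm + dq * m) / 2)
  + q * (t * dq) * (nb0 ^+ 2 + nb1 ^+ 2 + nb2 ^+ 2 - qb * mb)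
  + q ^+ 2 * tb * (nb0 * db0 + nb1 * db1 + nb2 * db2 - (qb * dmb + dqb * mb) / 2));
  last by rewrite E1 E2 E1b E2b !mulr0 !addr0.
by rewrite /v /dv /g /dg /k /dk; field.
Qed.

(** This is conformality: nullity kills the parts in [t * r] and [tb * rb], and what survives is a
    multiple of the Euclidean product [t * rb + tb * r]. *)
Lemma light_cone_metric t tb r rb :
  dv t tb n0 nb0 d0 db0 * dv r rb n0 nb0 d0 db0
    + dv t tb n1 nb1 d1 db1 * dv r rb n1 nb1 d1 db1
    + dv t tb n2 nb2 d2 db2 * dv r rb n2 nb2 d2 db2
    + (dg t tb - dk t tb) * (dg r rb - dk r rb)
  = (dg t tb + dk t tb) * (dg r rb + dk r rb)
    + (t * rb + tb * r) *
      ((d0 * q - n0 * dq) * (db0 * qb - nb0 * dqb)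
       + (d1 * q - n1 * dq) * (db1 * qb - nb1 * dqb)
       + (d2 * q - n2 * dq) * (db2 * qb - nb2 * dqb)).
Proof.
apply/eqP; rewrite -subr_eq0; apply/eqP.
transitivity (t * r * (qb ^+ 2 * (d0 ^+ 2 + d1 ^+ 2 + d2 ^+ 2 - dq * dm)
    + dq ^+ 2 * (nb0 ^+ 2 + nb1 ^+ 2 + nb2 ^+ 2 - qb * mb))
  + tb * rb * (q ^+ 2 * (db0 ^+ 2 + db1 ^+ 2 + db2 ^+ 2 - dqb * dmb)
    + dqb ^+ 2 * (n0 ^+ 2 + n1 ^+ 2 + n2 ^+ 2 - q * m))
  + (t * rb + tb * r) * (
     qb * dqb * (n0 * d0 + n1 * d1 + n2 * d2 - (q * dm + dq * m) / 2)
     + q * dq * (nb0 * db0 + nb1 * db1 + nb2 * db2 - (qb * dmb + dqb * mb) / 2)));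
  last by rewrite E1 E2 E3 E1b E2b E3b !mulr0 !addr0 !mulr0 !addr0.
by rewrite /v /dv /g /dg /k /dk; field.
Qed.

(** The entries are the numerators of the derivative of [n / q], so this is the isotropy behind
    conformality of the real part. The contributions of [m] and [dm] cancel. *)
Lemma null_derivative :
  (d0 * q - n0 * dq) ^+ 2 + (d1 * q - n1 * dq) ^+ 2 + (d2 * q - n2 * dq) ^+ 2 = 0.
Proof.
transitivity (q ^+ 2 * (d0 ^+ 2 + d1 ^+ 2 + d2 ^+ 2 - dq * dm)
  - 2 * q * dq * (n0 * d0 + n1 * d1 + n2 * d2 - (q * dm + dq * m) / 2)
  + dq ^+ 2 * (n0 ^+ 2 + n1 ^+ 2 + n2 ^+ 2 - q * m));
  last by rewrite E1 E2 E3 !mulr0 subr0 addr0.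
by field.
Qed.

End LightCone.

(** * Null curves and their lift to the sphere *)

(* A null curve [(nc0, nc1, nc2) / ncq] in C^3, written with polynomials so that
   [(nc0, nc1, nc2, ncq, ncm)] is a light-like curve in C^5. *)
Record null_curve (R : realType) := NullCurve {
  nc0 : {poly R[i]}; nc1 : {poly R[i]}; nc2 : {poly R[i]};
  ncq : {poly R[i]}; ncm : {poly R[i]};
  nc_null : nc0 ^+ 2 + nc1 ^+ 2 + nc2 ^+ 2 = ncq * ncm;
  nc_null' : nc0^`() ^+ 2 + nc1^`() ^+ 2 + nc2^`() ^+ 2 = ncq^`() * ncm^`();
  nc_immersed : forall z,
    [|| (nc0^`() * ncq - nc0 * ncq^`()).[z] != 0,
        (nc1^`() * ncq - nc1 * ncq^`()).[z] != 0
      | (nc2^`() * ncq - nc2 * ncq^`()).[z] != 0] }.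

Definition wnorm2 (R : realType) (p : {poly R[i]}) : wexp R :=
  WMul (WHol p) (WConj (WHol p)).

(** Twice the real part of [p] times the conjugate of [q]. *)
Definition wreal (R : realType) (p q : {poly R[i]}) : wexp R :=
  WAdd (WMul (WHol p) (WConj (WHol q))) (WMul (WConj (WHol p)) (WHol q)).

(* [nc_g], [nc_sum] and [nc_cone] are g, g + k and (v, g - k) of the header. *)
Definition nc_g (R : realType) (c : null_curve R) : wexp R :=
  WAdd (WMul (WHol (4^-1)%:P) (wreal (ncm c) (ncq c)))
    (WMul (WHol (2^-1)%:P)
       (WAdd (WAdd (wnorm2 (nc0 c)) (wnorm2 (nc1 c))) (wnorm2 (nc2 c)))).

Definition nc_sum (R : realType) (c : null_curve R) : wexp R :=
  WAdd (nc_g c) (wnorm2 (ncq c)).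

Definition nc_cone (R : realType) (c : null_curve R) (j : nat) : wexp R :=
  nth (WHol 0) [:: wreal (nc0 c) (ncq c); wreal (nc1 c) (ncq c); wreal (nc2 c) (ncq c);
    WAdd (nc_g c) (WMul (WHol (-1)%:P) (wnorm2 (ncq c)))] j.

Definition nc_lift_exp (R : realType) (c : null_curve R) (j : nat) : wexp R :=
  WMul (nc_cone c j) (WInv (nc_sum c)).

Definition nc_lift (R : realType) (c : null_curve R) (z : R[i]) : 'rV[R]_4 :=
  \row_j Re (weval (nc_lift_exp c j) z).

Lemma wevalD (R : realType) (e f : wexp R) z : weval (WAdd e f) z = weval e z + weval f z.
Proof. by []. Qed.

Lemma wevalM (R : realType) (e f : wexp R) z : weval (WMul e f) z = weval e z * weval f z.
Proof. by []. Qed.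

Lemma weval_cst (R : realType) (a : R[i]) z : weval (WHol a%:P) z = a.
Proof. exact: hornerC. Qed.

Lemma conjc_fixD (R : realType) (a b : R[i]) : a^* = a -> b^* = b -> (a + b)^* = a + b.
Proof. by move=> ha hb; rewrite rmorphD /= ha hb. Qed.

Lemma conjc_fixM (R : realType) (a b : R[i]) : a^* = a -> b^* = b -> (a * b)^* = a * b.
Proof. by move=> ha hb; rewrite rmorphM /= ha hb. Qed.

Lemma conjc_fixV (R : realType) (a : R[i]) : a^* = a -> (a^-1)^* = a^-1.
Proof. by move=> ha; rewrite conjc_inv ha. Qed.

Lemma real_complex_Re (R : realType) (x : R[i]) : x^* = x -> (Re x)%:C = x.
Proof.
case: x => a b [] /eqP; rewrite eq_sym -subr_eq0 opprK -mulr2n mulrn_eq0 /=.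
by move/eqP => ->.
Qed.

Lemma wreal_real (R : realType) (p q : {poly R[i]}) z :
  (weval (wreal p q) z)^* = weval (wreal p q) z.
Proof. by rewrite /= rmorphD !rmorphM /= !conjcK addrC. Qed.

Lemma wnorm2_real (R : realType) (p : {poly R[i]}) z :
  (weval (wnorm2 p) z)^* = weval (wnorm2 p) z.
Proof. by rewrite /= rmorphM /= conjcK mulrC. Qed.

Lemma nc_g_real (R : realType) (c : null_curve R) z :
  (weval (nc_g c) z)^* = weval (nc_g c) z.
Proof.
apply: conjc_fixD; apply: conjc_fixM; rewrite ?hornerC ?wreal_real //.
- by apply: conjc_fixV; exact: conjc_nat.
- by apply: conjc_fixV; exact: conjc_nat.
- by apply: conjc_fixD; [apply: conjc_fixD|]; exact: wnorm2_real.
Qed.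

Lemma nc_sum_real (R : realType) (c : null_curve R) z :
  (weval (nc_sum c) z)^* = weval (nc_sum c) z.
Proof.
by apply: conjc_fixD; [exact: nc_g_real|exact: wnorm2_real].
Qed.

Lemma nc_cone_real (R : realType) (c : null_curve R) (j : 'I_4) z :
  (weval (nc_cone c j) z)^* = weval (nc_cone c j) z.
Proof.
case: j => -[|[|[|[|//]]]] ?; try exact: wreal_real.
apply: conjc_fixD; first exact: nc_g_real.
by apply: conjc_fixM; [rewrite hornerC rmorphN1|exact: wnorm2_real].
Qed.

Lemma nc_lift_exp_real (R : realType) (c : null_curve R) (j : 'I_4) z :
  (weval (nc_lift_exp c j) z)^* = weval (nc_lift_exp c j) z.
Proof.
by apply: conjc_fixM; [exact: nc_cone_real|apply: conjc_fixV; exact: nc_sum_real].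
Qed.

Lemma horner_eq (R : realType) (p q : {poly R[i]}) : p = q -> forall z, p.[z] = q.[z].
Proof. by move=> ->. Qed.

Lemma nc_null_val (R : realType) (c : null_curve R) z :
  (nc0 c).[z] ^+ 2 + (nc1 c).[z] ^+ 2 + (nc2 c).[z] ^+ 2 - (ncq c).[z] * (ncm c).[z] = 0.
Proof. by rewrite -!horner_exp -!hornerD nc_null hornerM subrr. Qed.

(** Half the derivative of [nc_null]. *)
Lemma nc_cross_val (R : realType) (c : null_curve R) z :
  (nc0 c).[z] * (nc0 c)^`().[z] + (nc1 c).[z] * (nc1 c)^`().[z]
   + (nc2 c).[z] * (nc2 c)^`().[z]
   - ((ncq c).[z] * (ncm c)^`().[z] + (ncq c)^`().[z] * (ncm c).[z]) / 2 = 0.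
Proof.
have /(congr1 (fun p => p^`())) := nc_null c.
move=> /horner_eq/(_ z); rewrite !expr2 !derivD !derivM !hornerD !hornerM => h.
have -> : (ncq c).[z] * (ncm c)^`().[z] + (ncq c)^`().[z] * (ncm c).[z] =
  2 * ((nc0 c).[z] * (nc0 c)^`().[z] + (nc1 c).[z] * (nc1 c)^`().[z]
   + (nc2 c).[z] * (nc2 c)^`().[z]).
  by rewrite addrC -h; ring.
by field.
Qed.

Lemma nc_null_deriv_val (R : realType) (c : null_curve R) z :
  (nc0 c)^`().[z] ^+ 2 + (nc1 c)^`().[z] ^+ 2 + (nc2 c)^`().[z] ^+ 2
   - (ncq c)^`().[z] * (ncm c)^`().[z] = 0.
Proof. by rewrite -!horner_exp -!hornerD nc_null' hornerM subrr. Qed.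

Lemma nc_null_conj (R : realType) (c : null_curve R) z :
  (nc0 c).[z]^* ^+ 2 + (nc1 c).[z]^* ^+ 2 + (nc2 c).[z]^* ^+ 2
    - (ncq c).[z]^* * (ncm c).[z]^* = 0.
Proof. by have /(congr1 (@conjc R)) := nc_null_val c z;
  rewrite !(rmorphB, rmorphD, rmorphM, rmorphXn, rmorph0). Qed.

Lemma nc_cross_conj (R : realType) (c : null_curve R) z :
  (nc0 c).[z]^* * (nc0 c)^`().[z]^* + (nc1 c).[z]^* * (nc1 c)^`().[z]^*
   + (nc2 c).[z]^* * (nc2 c)^`().[z]^*
   - ((ncq c).[z]^* * (ncm c)^`().[z]^* + (ncq c)^`().[z]^* * (ncm c).[z]^*) / 2 = 0.
Proof.
have /(congr1 (@conjc R)) := nc_cross_val c z.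
by rewrite !(rmorphB, rmorphD, rmorphM, rmorphXn, rmorph0) fmorphV rmorph_nat.
Qed.

Lemma nc_null_deriv_conj (R : realType) (c : null_curve R) z :
  (nc0 c)^`().[z]^* ^+ 2 + (nc1 c)^`().[z]^* ^+ 2 + (nc2 c)^`().[z]^* ^+ 2
   - (ncq c)^`().[z]^* * (ncm c)^`().[z]^* = 0.
Proof. by have /(congr1 (@conjc R)) := nc_null_deriv_val c z;
  rewrite !(rmorphB, rmorphD, rmorphM, rmorphXn, rmorph0). Qed.

Lemma nc_light_cone (R : realType) (c : null_curve R) z :
  \sum_(j < 4) weval (nc_cone c j) z ^+ 2 = weval (nc_sum c) z ^+ 2.
Proof.
have := light_cone (nc_null_val c z) (nc_null_conj c z) => h.
rewrite !big_ord_recl big_ord0 /= !hornerC addr0 !addrA.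
rewrite mulN1r; set S := (X in _ = X ^+ 2).
transitivity ((((ncm c).[z] * (ncq c).[z]^* + (ncm c).[z]^* * (ncq c).[z]) / 4 +
   ((nc0 c).[z] * (nc0 c).[z]^* + (nc1 c).[z] * (nc1 c).[z]^* +
    (nc2 c).[z] * (nc2 c).[z]^*) / 2 + (ncq c).[z] * (ncq c).[z]^*) ^+ 2).
  by rewrite -h; field.
by rewrite /S; field.
Qed.

Lemma wdiff_wreal (R : realType) t (p q : {poly R[i]}) z :
  weval (wdiff t (wreal p q)) z =
  t * p^`().[z] * q.[z]^* + p.[z] * (t^* * q^`().[z]^*)
  + (t^* * p^`().[z]^* * q.[z] + p.[z]^* * (t * q^`().[z])).
Proof. by rewrite /= !hornerZ !rmorphM. Qed.

Lemma wdiff_wnorm2 (R : realType) t (p : {poly R[i]}) z :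
  weval (wdiff t (wnorm2 p)) z =
  t * p^`().[z] * p.[z]^* + p.[z] * (t^* * p^`().[z]^*).
Proof. by rewrite /= !hornerZ !rmorphM. Qed.

Lemma wdiff_cstM (R : realType) t (a : R[i]) (e : wexp R) z :
  weval (wdiff t (WMul (WHol a%:P) e)) z = a * weval (wdiff t e) z.
Proof. by rewrite /= derivC scaler0 horner0 hornerC mul0r add0r. Qed.

Lemma wdiffD (R : realType) t (e f : wexp R) z :
  weval (wdiff t (WAdd e f)) z = weval (wdiff t e) z + weval (wdiff t f) z.
Proof. by []. Qed.

Lemma nc_gE (R : realType) (c : null_curve R) z :
  weval (nc_g c) z =
  ((ncm c).[z] * (ncq c).[z]^* + (ncm c).[z]^* * (ncq c).[z]) / 4
  + ((nc0 c).[z] * (nc0 c).[z]^* + (nc1 c).[z] * (nc1 c).[z]^*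
     + (nc2 c).[z] * (nc2 c).[z]^*) / 2.
Proof. by rewrite /nc_g wevalD !wevalM !weval_cst ![_^-1 * _]mulrC. Qed.

Lemma wdiff_nc_gE (R : realType) t (c : null_curve R) z :
  weval (wdiff t (nc_g c)) z =
  (t * (ncm c)^`().[z] * (ncq c).[z]^* + (ncm c).[z] * (t^* * (ncq c)^`().[z]^*)
   + (t^* * (ncm c)^`().[z]^* * (ncq c).[z] + (ncm c).[z]^* * (t * (ncq c)^`().[z]))) / 4
  + (t * (nc0 c)^`().[z] * (nc0 c).[z]^* + (nc0 c).[z] * (t^* * (nc0 c)^`().[z]^*)
   + (t * (nc1 c)^`().[z] * (nc1 c).[z]^* + (nc1 c).[z] * (t^* * (nc1 c)^`().[z]^*))
   + (t * (nc2 c)^`().[z] * (nc2 c).[z]^* + (nc2 c).[z] * (t^* * (nc2 c)^`().[z]^*))) / 2.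
Proof.
by rewrite /nc_g wdiffD !wdiff_cstM wdiff_wreal !wdiffD !wdiff_wnorm2 ![_^-1 * _]mulrC.
Qed.

Lemma nc_cone3E (R : realType) (c : null_curve R) z :
  weval (nc_cone c 3%N) z = weval (nc_g c) z - (ncq c).[z] * (ncq c).[z]^*.
Proof.
have -> : nc_cone c 3%N = WAdd (nc_g c) (WMul (WHol (-1)%:P) (wnorm2 (ncq c))) by [].
by rewrite wevalD wevalM weval_cst mulN1r. Qed.

Lemma wdiff_nc_cone3E (R : realType) t (c : null_curve R) z :
  weval (wdiff t (nc_cone c 3%N)) z = weval (wdiff t (nc_g c)) z
   - (t * (ncq c)^`().[z] * (ncq c).[z]^* + (ncq c).[z] * (t^* * (ncq c)^`().[z]^*)).
Proof.
have -> : nc_cone c 3%N = WAdd (nc_g c) (WMul (WHol (-1)%:P) (wnorm2 (ncq c))) by [].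
by rewrite wdiffD wdiff_cstM wdiff_wnorm2 mulN1r. Qed.

Lemma nc_sumE (R : realType) (c : null_curve R) z :
  weval (nc_sum c) z = weval (nc_g c) z + (ncq c).[z] * (ncq c).[z]^*.
Proof. by []. Qed.

Lemma wdiff_nc_sumE (R : realType) t (c : null_curve R) z :
  weval (wdiff t (nc_sum c)) z = weval (wdiff t (nc_g c)) z
   + (t * (ncq c)^`().[z] * (ncq c).[z]^* + (ncq c).[z] * (t^* * (ncq c)^`().[z]^*)).
Proof. by rewrite /nc_sum wdiffD wdiff_wnorm2. Qed.

Lemma nc_cone_sum (R : realType) (c : null_curve R) (F : wexp R -> R[i]) :
  \sum_(j < 4) F (nc_cone c j) =
  F (wreal (nc0 c) (ncq c)) + F (wreal (nc1 c) (ncq c)) + F (wreal (nc2 c) (ncq c))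
  + F (nc_cone c 3%N).
Proof. by rewrite !big_ord_recl big_ord0 addr0 !addrA. Qed.

Lemma nc_light_cone_tangent (R : realType) (c : null_curve R) t z :
  \sum_(j < 4) weval (nc_cone c j) z * weval (wdiff t (nc_cone c j)) z =
  weval (nc_sum c) z * weval (wdiff t (nc_sum c)) z.
Proof.
rewrite (nc_cone_sum c (fun e => weval e z * weval (wdiff t e) z)); cbv beta.
rewrite nc_cone3E wdiff_nc_cone3E wdiff_nc_sumE nc_sumE nc_gE wdiff_nc_gE !wdiff_wreal.
exact: (light_cone_tangent (nc_null_val c z) (nc_cross_val c z) (nc_null_conj c z) (nc_cross_conj c z) t t^*).
Qed.

Lemma nc_light_cone_metric (R : realType) (c : null_curve R) t r z :
  \sum_(j < 4) weval (wdiff t (nc_cone c j)) z * weval (wdiff r (nc_cone c j)) z =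
  weval (wdiff t (nc_sum c)) z * weval (wdiff r (nc_sum c)) z +
  (t * r^* + t^* * r) *
  (`|((nc0 c)^`() * ncq c - nc0 c * (ncq c)^`()).[z]| ^+ 2 +
   `|((nc1 c)^`() * ncq c - nc1 c * (ncq c)^`()).[z]| ^+ 2 +
   `|((nc2 c)^`() * ncq c - nc2 c * (ncq c)^`()).[z]| ^+ 2).
Proof.
rewrite (nc_cone_sum c (fun e => weval (wdiff t e) z * weval (wdiff r e) z)); cbv beta.
rewrite !wdiff_nc_cone3E !wdiff_nc_sumE !wdiff_nc_gE !wdiff_wreal
  !sqr_normc !hornerD !hornerN !hornerM !rmorphB !rmorphM.
exact: (light_cone_metric (nc_null_val c z) (nc_cross_val c z) (nc_null_deriv_val c z)
  (nc_null_conj c z) (nc_cross_conj c z)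
  (nc_null_deriv_conj c z) t t^* r r^*).
Qed.

(** If the sum vanished, the cone relation between real numbers would make every coordinate vanish.
    Then [q = 0], next [|N|^2 = 0], so [N = 0], and [N' q - N q'] would vanish against
    [nc_immersed]. *)
Lemma nc_sum_neq0 (R : realType) (c : null_curve R) z : weval (nc_sum c) z != 0.
Proof.
have sge0 (x : R[i]) : x^* = x -> 0 <= x ^+ 2.
  by move=> xE; rewrite expr2 -{2}xE mulcJ_ge0.
apply/negP => /eqP s0.
have := nc_light_cone c z; rewrite s0 expr0n /= => /eqP.
rewrite psumr_eq0; last by move=> j _; apply: sge0; exact: nc_cone_real.
move=> /allP cone0.
have /eqP t0 : weval (nc_cone c 3%N) z == 0.
  by have := cone0 (@Ordinal 4%N 3%N isT) (mem_index_enum _); rewrite sqrf_eq0.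
have q0 : (ncq c).[z] = 0.
  (* The difference of [g + k] and [g - k] is [2 |q|^2]. *)
  have : weval (nc_sum c) z - weval (nc_cone c 3%N) z = 0 by rewrite s0 t0 subr0.
  rewrite nc_cone3E nc_sumE opprD opprK addrACA subrr add0r => /eqP.
  by rewrite -mulr2n mulrn_eq0 /= mulf_eq0 conjc_eq0 orbb => /eqP.
have := s0; rewrite nc_sumE nc_gE q0 !rmorph0 !(mulr0, mul0r, addr0, add0r) => /eqP.
rewrite mulf_eq0 invr_eq0 pnatr_eq0 orbF.
rewrite !paddr_eq0 ?addr_ge0 ?mulcJ_ge0 // !mulf_eq0 !conjc_eq0 !orbb.
move=> /andP[/andP[/eqP a0 /eqP b0] /eqP c0].
have := nc_immersed c z.
by rewrite !hornerD !hornerN !hornerM q0 a0 b0 c0 !mulr0 !mul0r subrr eqxx.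
Qed.

Lemma wdom_nc_lift (R : realType) (c : null_curve R) (j : 'I_4) z :
  wdom (nc_lift_exp c j) z.
Proof.
rewrite [wdom _ _]/(wdom (nc_cone c j) z && (wdom (nc_sum c) z && (weval (nc_sum c) z != 0))).
rewrite nc_sum_neq0.
by case: j => -[|[|[|[|//]]]].
Qed.

(** The left side is twice the Euclidean inner product of two coordinate directions; this turns
    [nc_lift_metric] into a scalar matrix. *)
Lemma plane_point_dir (R : realType) (i j : 'I_2) :
  let t := plane_point (delta_mx 0 i : 'rV[R]_2) in
  let r := plane_point (delta_mx 0 j : 'rV[R]_2) in
  t * r^* + t^* * r = 2 * (i == j)%:R.
Proof.
have -> : 2 * (i == j)%:R = (2 * (i == j)%:R : R)%:C.
  by rewrite rmorphM !rmorph_nat.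
case: i => [[|[|//]] ?]; case: j => [[|[|//]] ?]; rewrite /plane_point !mxE /=;
  apply/eqP; rewrite eq_complex /= -?val_eqE /=; apply/andP; split;
  apply/eqP; ring.
Qed.

Lemma Re_sumM (R : realType) (n : nat) (f g : 'I_n -> R[i]) :
  (forall i, (f i)^* = f i) -> (forall i, (g i)^* = g i) ->
  (\sum_i Re (f i) * Re (g i))%:C = \sum_i f i * g i.
Proof.
move=> hf hg; rewrite rmorph_sum; apply: eq_bigr => i _.
by rewrite rmorphM /= !real_complex_Re.
Qed.

Lemma conjc_Im0 (R : realType) (x : R[i]) : x^* = x <-> Im x = 0.
Proof.
split=> [/real_complex_Re <- //|]; case: x => a b /= ->.
by rewrite oppr0.
Qed.

(** The imaginary part is constantly 0, hence so is its derivative. This lets sums of real parts be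
    computed as complex sums. *)
Lemma wdiff_real (R : realType) (e : wexp R) (u v : 'rV[R]_2) :
  (forall z, (weval e z)^* = weval e z) -> wdom e (plane_point u) ->
  let d := weval (wdiff (plane_point v) e) (plane_point u) in d^* = d.
Proof.
move=> er edom d; apply/conjc_Im0.
have [_] := @is_cderive_weval R u v e edom.
have -> : (fun x => Im (weval e (plane_point x))) = cst 0.
  by apply/funext => x; apply/conjc_Im0.
by move=> h; rewrite -(@derive_val _ _ _ _ _ _ _ h) derive_cst.
Qed.

Definition nc_energy (R : realType) (c : null_curve R) (z : R[i]) : R[i] :=
  `|((nc0 c)^`() * ncq c - nc0 c * (ncq c)^`()).[z]| ^+ 2 +
  `|((nc1 c)^`() * ncq c - nc1 c * (ncq c)^`()).[z]| ^+ 2 +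
  `|((nc2 c)^`() * ncq c - nc2 c * (ncq c)^`()).[z]| ^+ 2.

Lemma nc_energy_gt0 (R : realType) (c : null_curve R) z : 0 < nc_energy c z.
Proof.
rewrite lt0r /nc_energy !addr_ge0 ?exprn_ge0 ?normr_ge0 // andbT.
rewrite !paddr_eq0 ?addr_ge0 ?exprn_ge0 ?normr_ge0 //.
rewrite !sqrf_eq0 !normr_eq0 !negb_and -orbA.
exact: nc_immersed.
Qed.

Lemma nc_lift_metric (R : realType) (c : null_curve R) t r z :
  \sum_(j < 4) weval (wdiff t (nc_lift_exp c j)) z * weval (wdiff r (nc_lift_exp c j)) z =
  (t * r^* + t^* * r) * nc_energy c z / weval (nc_sum c) z ^+ 2.
Proof.
have s0 := nc_sum_neq0 c z.
have E (s : R[i]) (j : 'I_4) : weval (wdiff s (nc_lift_exp c j)) z =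
  weval (wdiff s (nc_cone c j)) z / weval (nc_sum c) z
  - weval (nc_cone c j) z * weval (wdiff s (nc_sum c)) z / weval (nc_sum c) z ^+ 2.
  rewrite [LHS]/(weval (wdiff s (nc_cone c j)) z * (weval (nc_sum c) z)^-1 +
    weval (nc_cone c j) z * ((-1)%:P.[z] *
     (weval (wdiff s (nc_sum c)) z * (weval (nc_sum c) z * weval (nc_sum c) z)^-1))).
  by rewrite hornerC -expr2 mulN1r mulrN mulrA.
under eq_bigr do rewrite !E.
apply: (projectivised_metric s0 (nc_light_cone c z) (nc_light_cone_tangent c t z)
  (nc_light_cone_tangent c r z)).
exact: nc_light_cone_metric.
Qed.

Lemma conformal_nc_lift (R : realType) (c : null_curve R) (X : 'rV[R]_2 -> 'rV[R]_4) :
  (forall u, X u = nc_lift c (plane_point u)) -> conformal_immersion_on setT X.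
Proof.
move=> XE.
pose e (j : 'I_4) := nc_lift_exp c j.
have edom u : [set: 'rV[R]_2] u -> forall j, wdom (e j) (plane_point u).
  by move=> _ j; exact: wdom_nc_lift.
have XE' u : [set: 'rV[R]_2] u -> X u = \row_j Re (weval (e j) (plane_point u)).
  by move=> _; rewrite XE.
split; first exact: (smooth_on_weval openT edom XE').
move=> u _; set z := plane_point u.
(* The conformal factor; the 2 comes from [plane_point_dir]. *)
pose l := 2 * nc_energy c z / weval (nc_sum c) z ^+ 2.
have Spos : 0 < weval (nc_sum c) z ^+ 2.
  rewrite -(real_complex_Re (nc_sum_real c z)) -rmorphXn /= ltcE /= eqxx /=.
  rewrite exprn_even_gt0 //=; apply: contra (nc_sum_neq0 c z) => /eqP S0.
  by rewrite -(real_complex_Re (nc_sum_real c z)) S0.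
have l0 : 0 < l by rewrite divr_gt0 // mulr_gt0 // ?nc_energy_gt0 ?ltr0n.
have lr : (Re l)%:C = l by apply: real_complex_Re; apply/conjc_Im0; exact: ger0_Im (ltW l0).
exists (Re l); first by move: l0; rewrite ltcE => /andP[].
apply/matrixP => i j; rewrite !mxE; apply: complexI.
rewrite /dotv.
have pE k : partial k X u = \row_j Re (weval (wdiff (plane_point (delta_mx 0 k)) (e j)) z).
  exact: (partials_weval [:: k] openT edom XE').
rewrite !pE; under eq_bigr do rewrite !mxE.
rewrite Re_sumM; last 2 first.
- by move=> k; apply: wdiff_real; [exact: nc_lift_exp_real|exact: wdom_nc_lift].
- by move=> k; apply: wdiff_real; [exact: nc_lift_exp_real|exact: wdom_nc_lift].
rewrite nc_lift_metric plane_point_dir rmorphMn /= lr /l.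
by case: eqP => _; rewrite ?(mulr1, mulr0, mul0r).
Qed.

(** * Stereographic projection of the lift *)

Definition north_pole (R : realType) : 'rV[R]_4 := delta_mx 0 ord_max.

Definition equator_frame (R : realType) : 'M[R]_(4, 3) :=
  \matrix_(i, j) (i == j :> nat)%:R.

Lemma sphere3_north_pole (R : realType) : sphere3 (north_pole R).
Proof.
rewrite /sphere3 /dotv /= (bigD1 ord_max) //= !mxE !eqxx mulr1 big1 ?addr0 // => i.
by move=> /negbTE h; rewrite !mxE h andbF mul0r.
Qed.

Lemma stereo_frame_equator (R : realType) : stereo_frame (north_pole R) (equator_frame R).
Proof.
split.
  apply/matrixP => i j; rewrite !mxE !big_ord_recl big_ord0 !mxE /=.
  case: i => [[|[|[|//]]] ?]; case: j => [[|[|[|//]]] ?]; rewrite -?val_eqE /=;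
    by rewrite !(mulr0, mul0r, mulr1, addr0, add0r).
apply/rowP => j; rewrite !mxE !big_ord_recl big_ord0 !mxE -?val_eqE /=.
by case: j => [[|[|[|//]]] ?]; rewrite !(mulr0, mul0r, mulr1, addr0, add0r).
Qed.

Lemma mulmx_equator_frame (R : realType) (x : 'rV[R]_4) (j : 'I_3) :
  (x *m equator_frame R) 0 j = x 0 (widen_ord (leqnSn 3) j).
Proof.
rewrite mxE (bigD1 (widen_ord (leqnSn 3) j)) //= !mxE eqxx mulr1 big1 ?addr0 // => i.
by rewrite -val_eqE /= => /negbTE h; rewrite !mxE h mulr0.
Qed.

Lemma dotv_north_pole (R : realType) (x : 'rV[R]_4) : dotv x (north_pole R) = x 0 ord_max.
Proof.
rewrite /dotv (bigD1 ord_max) //= !mxE !eqxx mulr1 big1 ?addr0 // => i.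
by move=> /negbTE h; rewrite !mxE h andbF mulr0.
Qed.

Lemma nc_lift_expE (R : realType) (c : null_curve R) (j : nat) z :
  weval (nc_lift_exp c j) z = weval (nc_cone c j) z / weval (nc_sum c) z.
Proof. by []. Qed.

Lemma sphere3_nc_lift (R : realType) (c : null_curve R) z : sphere3 (nc_lift c z).
Proof.
rewrite /sphere3 /dotv /=; apply: complexI.
under eq_bigr do rewrite !mxE.
rewrite Re_sumM; try by move=> j; exact: nc_lift_exp_real.
rewrite -[RHS](divff (_ : weval (nc_sum c) z ^+ 2 != 0)) ?expf_neq0 ?nc_sum_neq0 //.
rewrite -{1}nc_light_cone mulr_suml; apply: eq_bigr => j _.
by rewrite nc_lift_expE -expr2 expr_div_n.
Qed.

(** This is [1 - (g - k) / (g + k) = 2 k / (g + k)], the denominator of the stereographic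
    projection; it vanishes exactly at the zeros of [q]. *)
Lemma nc_lift_last (R : realType) (c : null_curve R) z :
  (1 - nc_lift c z 0 ord_max)%:C =
  2 * ((ncq c).[z] * (ncq c).[z]^*) / weval (nc_sum c) z.
Proof.
have h := real_complex_Re (nc_lift_exp_real c ord_max z).
rewrite mxE rmorphB [X in _ - X]h nc_lift_expE (_ : nat_of_ord ord_max = 3%N) // nc_cone3E.
have s0 := nc_sum_neq0 c z.
rewrite -[X in X - _](divff s0) -mulrBl nc_sumE; congr (_ / _).
by ring.
Qed.

Lemma nc_lift_north_pole (R : realType) (c : null_curve R) z :
  nc_lift c z = north_pole R <-> (ncq c).[z] = 0.
Proof.
split=> [h|q0].
  have := nc_lift_last c z; rewrite h mxE !eqxx subrr => /esym/eqP.
  rewrite !mulf_eq0 invr_eq0 (negbTE (nc_sum_neq0 c z)) conjc_eq0 pnatr_eq0 orbF orbb.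
  by move/eqP.
apply/rowP => j; rewrite !mxE nc_lift_expE eqxx.
have s0 := nc_sum_neq0 c z.
case: j => [[|[|[|[|//]]]] jl] ; rewrite -val_eqE.
all: rewrite [nat_of_ord _]/= .
4: rewrite nc_cone3E nc_sumE q0 mul0r subr0 addr0; have := s0; rewrite nc_sumE q0 mul0r addr0 => g0;
  by rewrite divff.
all: by rewrite /= q0 rmorph0 !mulr0 addr0 mul0r.
Qed.

Definition nc_num (R : realType) (c : null_curve R) (j : nat) : {poly R[i]} :=
  [:: nc0 c; nc1 c; nc2 c]`_j.

Definition nc_curve (R : realType) (c : null_curve R) (z : R[i]) : 'rV[R]_3 :=
  \row_j Re ((nc_num c j).[z] / (ncq c).[z]).

(** Dividing [v / (g + k)] by [2 k / (g + k)] leaves [v / (2 k)], which is the real part of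
    [N / q]. *)
Lemma stereo_nc_lift (R : realType) (c : null_curve R) z :
  (ncq c).[z] != 0 ->
  stereo (north_pole R) (equator_frame R) (nc_lift c z) = nc_curve c z.
Proof.
move=> q0; apply/rowP => j.
rewrite /stereo dotv_north_pole mxE mulmx_equator_frame [RHS]mxE.
apply: complexI; rewrite rmorphM fmorphV /= nc_lift_last mxE.
rewrite (real_complex_Re (nc_lift_exp_real c (widen_ord (leqnSn 3) j) z)) nc_lift_expE.
have s0 := nc_sum_neq0 c z.
have qc0 : (ncq c).[z]^* != 0 by rewrite conjc_eq0.
rewrite ReJ_add rmorphM fmorphV /=.
have -> : weval (nc_cone c j) z =
   (nc_num c j).[z] * (ncq c).[z]^* + (nc_num c j).[z]^* * (ncq c).[z].
  by case: j => [[|[|[|//]]] ?].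
by move: s0 q0 qc0 => /=; set s := weval (nc_sum c) z => s0 q0 qc0; field; rewrite s0 q0 qc0.
Qed.

(** * Minimality of the real part of a null curve *)

Lemma open_horner_neq0 (R : realType) (p : {poly R[i]}) :
  open [set u : 'rV[R]_2 | p.[plane_point u] != 0].
Proof.
have -> : [set u : 'rV[R]_2 | p.[plane_point u] != 0] =
   (fun u => Re p.[plane_point u] ^+ 2 + Im p.[plane_point u] ^+ 2) @^-1` [set x | x != 0].
  apply/seteqP; split=> u /=; first exact: normsq_neq0.
  by apply: contra => /eqP ->; rewrite /= expr0n /= addr0.
apply: open_comp; last exact: open_neq.
move=> u _; have [hr hi] := ccontinuous_horner u p.
rewrite (_ : (fun x => _) = (fun x => Re p.[plane_point x]) * (fun x => Re p.[plane_point x])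
     + (fun x => Im p.[plane_point x]) * (fun x => Im p.[plane_point x])).
  by apply: continuousD; exact: continuousM.
by apply/funext => x; rewrite !expr2.
Qed.

Definition nc_curve_exp (R : realType) (c : null_curve R) (j : nat) : wexp R :=
  WMul (WHol (nc_num c j)) (WInv (WHol (ncq c))).

Lemma wdiff_nc_curve (R : realType) (c : null_curve R) j t z :
  (ncq c).[z] != 0 ->
  weval (wdiff t (nc_curve_exp c j)) z =
  t * (((nc_num c j)^`() * ncq c - nc_num c j * (ncq c)^`()).[z] / (ncq c).[z] ^+ 2).
Proof.
by move=> q0; rewrite /= !(hornerZ, hornerC, hornerD, hornerN, hornerM); field; rewrite q0.
Qed.

(** Holomorphy: the second derivative is quadratic in the direction, so those along 1 and i add up
    to 0 and the real part is harmonic. *)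
Lemma wdiff2_nc_curve (R : realType) (c : null_curve R) j t z :
  (ncq c).[z] != 0 ->
  weval (wdiff t (wdiff t (nc_curve_exp c j))) z =
  t ^+ 2 * weval (wdiff 1 (wdiff 1 (nc_curve_exp c j))) z.
Proof.
move=> q0; rewrite /= !(derivZ, hornerZ, hornerC, derivC, horner0).
by field; rewrite q0.
Qed.

(** The real and imaginary parts of an isotropic vector are orthogonal and of equal length; the
    directions 1 and i yield [Re h] and [- Im h]. *)
Lemma isotropic_Re (R : realType) (h : 'I_3 -> R[i]) :
  \sum_l h l ^+ 2 = 0 -> forall i j : 'I_2,
  \sum_l Re (plane_point (delta_mx 0 i : 'rV[R]_2) * h l)
       * Re (plane_point (delta_mx 0 j : 'rV[R]_2) * h l) =
  (\sum_l Re (h l) ^+ 2) *+ (i == j).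
Proof.
move=> h0.
have hr : \sum_l Im (h l) ^+ 2 = \sum_l Re (h l) ^+ 2.
  apply/eqP; rewrite eq_sym -subr_eq0 -sumrB; apply/eqP.
  have /(congr1 (@complex.Re R)) := h0; rewrite !big_ord_recl !big_ord0 !expr2 !(complexReD, complexReM) /=.
  by move=> e; rewrite -[RHS]e; ring.
have hi : \sum_l Re (h l) * Im (h l) = 0.
  have /(congr1 (@complex.Im R)) := h0; rewrite !big_ord_recl !big_ord0 !expr2 !(complexImD, complexImM) /=.
  move=> e; apply: (mulfI (_ : (2 : R) != 0)); first by rewrite pnatr_eq0.
  by rewrite mulr0 -[RHS]e; ring.
case=> [[|[|//]] ?] [[|[|//]] ?]; rewrite -val_eqE /= ?mulr1n ?mulr0n.
- by apply: eq_bigr => l _; rewrite !complexReM /plane_point !mxE /=; ring.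
- transitivity (- (\sum_l Re (h l) * Im (h l))); last by rewrite hi oppr0.
  rewrite -sumrN.
  by apply: eq_bigr => l _; rewrite !complexReM /plane_point !mxE /=; ring.
- transitivity (- (\sum_l Re (h l) * Im (h l))); last by rewrite hi oppr0.
  rewrite -sumrN.
  by apply: eq_bigr => l _; rewrite !complexReM /plane_point !mxE /=; ring.
- by rewrite -hr; apply: eq_bigr => l _; rewrite !complexReM /plane_point !mxE /=; ring.
Qed.

(** In conformal coordinates the trace of the shape operator is, up to the conformal factor, the
    inner product of the Laplacian with the normal. *)
Lemma mean_curvature_harmonic (R : realType) (X : 'rV[R]_2 -> 'rV[R]_3) u (l : R) :
  fund1 X u = l%:M ->
  partial 0 (partial 0 X) u + partial 1 (partial 1 X) u = 0 ->
  mean_curvature X u = 0.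
Proof.
move=> f1 harm; rewrite /mean_curvature f1 invmx_scalar mul_scalar_mx mxtraceZ.
have -> : \tr (fund2 X u) = 0; last by rewrite mulr0 mul0r.
rewrite /mxtrace !big_ord_recl big_ord0 addr0 !mxE /dotv -big_split /= big1 // => k _.
rewrite -mulrDl.
have /rowP/(_ k) := harm; rewrite !mxE => e.
by rewrite (_ : lift ord0 ord0 = 1) ?e ?mul0r //; exact/val_inj.
Qed.

Lemma minimal_nc_curve (R : realType) (c : null_curve R) (U : set 'rV[R]_2)
    (X : 'rV[R]_2 -> 'rV[R]_3) :
  U = [set u | (ncq c).[plane_point u] != 0] ->
  (forall u, U u -> X u = nc_curve c (plane_point u)) ->
  conformal_immersion_on U X /\ forall u, U u -> mean_curvature X u = 0.
Proof.
move=> UE XE.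
have oU : open U by rewrite UE; exact: open_horner_neq0.
pose e (j : 'I_3) := nc_curve_exp c j.
have edom u : U u -> forall j, wdom (e j) (plane_point u) by rewrite UE.
have XE' u : U u -> X u = \row_j Re (weval (e j) (plane_point u)) by exact: XE.
have pE s u := @partials_weval R _ U X e s oU edom XE' u.
have [lam lam0 f1] : exists2 lam : 'rV[R]_2 -> R, forall u, U u -> 0 < lam u &
    forall u, U u -> fund1 X u = (lam u)%:M.
  (* The complex derivative of [N / q], isotropic by [null_derivative]. *)
  pose h u (j : 'I_3) := ((nc_num c j)^`() * ncq c - nc_num c j * (ncq c)^`()).[plane_point u]
    / (ncq c).[plane_point u] ^+ 2.
  have h0 u : U u -> \sum_j h u j ^+ 2 = 0.
    rewrite UE /= => q0; under eq_bigr do rewrite /h expr_div_n.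
    rewrite -mulr_suml !big_ord_recl big_ord0 addr0 addrA !hornerD !hornerN !hornerM.
    by rewrite (null_derivative (nc_null_val c _) (nc_cross_val c _) (nc_null_deriv_val c _)) mul0r.
  exists (fun u => \sum_j Re (h u j) ^+ 2) => u Uu.
    rewrite lt0r sumr_ge0 ?andbT; last by move=> *; exact: sqr_ge0.
    apply/negP => /eqP s0.
    (* By isotropy a vanishing real part forces a vanishing imaginary part, so [h] would be 0
       against [nc_immersed]. *)
    have s0' : \sum_j Im (h u j) ^+ 2 = 0.
      have := isotropic_Re (h0 u Uu) 1 1; rewrite eqxx s0 mul0rn => e0; rewrite -[RHS]e0.
      by apply: eq_bigr => l _; rewrite !complexReM /plane_point !mxE /=; ring.
    have hj0 j : h u j = 0.
      apply/eqP; rewrite eq_complex; apply/andP; split; rewrite -sqrf_eq0.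
      - move/eqP: s0; rewrite psumr_eq0; last by move=> *; exact: sqr_ge0.
        by move/allP/(_ j (mem_index_enum _)).
      - move/eqP: s0'; rewrite psumr_eq0; last by move=> *; exact: sqr_ge0.
        by move/allP/(_ j (mem_index_enum _)).
    have q0 : (ncq c).[plane_point u] != 0 by move: Uu; rewrite UE.
    have W0 j : ((nc_num c j)^`() * ncq c - nc_num c j * (ncq c)^`()).[plane_point u] = 0.
      have /eqP := hj0 (inord j); rewrite mulf_eq0 invr_eq0 (negbTE (expf_neq0 2 q0)) orbF.
      case: (ltnP j 3) => [j3|j3 _]; first by rewrite inordK // => /eqP.
      by rewrite /nc_num nth_default // deriv0 !mul0r subrr horner0.
    have := nc_immersed c (plane_point u).
    by rewrite (W0 0%N) (W0 1%N) (W0 2%N) eqxx.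
  apply/matrixP => i j; rewrite !mxE -(isotropic_Re (h0 u Uu)) /dotv.
  have p1 k : partial k X u = \row_j Re (weval (wdiff (plane_point (delta_mx 0 k)) (e j)) (plane_point u)).
    exact: (pE [:: k]).
  rewrite !p1; apply: eq_bigr => l _; rewrite !mxE !wdiff_nc_curve //; by move: Uu; rewrite UE.
split; first split.
- exact: smooth_on_weval XE'.
- by move=> u Uu; exists (lam u); [exact: lam0|exact: f1].
move=> u Uu; apply: (mean_curvature_harmonic (f1 u Uu)).
have p2 k : partial k (partial k X) u = \row_j Re (weval (wdiff (plane_point (delta_mx 0 k))
    (wdiff (plane_point (delta_mx 0 k)) (e j))) (plane_point u)).
  exact: (pE [:: k; k]).
have q0 : (ncq c).[plane_point u] != 0 by move: Uu; rewrite UE.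
rewrite !p2; apply/rowP => j; rewrite !mxE -complexReD.
rewrite [X in Re (X + _)](wdiff2_nc_curve _ _ q0) [X in Re (_ + X)](wdiff2_nc_curve _ _ q0).
rewrite -mulrDl.
(* The two directions are 1 and i, whose squares add up to 0. *)
rewrite (_ : _ + _ = 0) ?mul0r // /plane_point !mxE /=.
by apply/eqP; rewrite !expr2 eq_complex /=; apply/andP; split; apply/eqP; ring.
Qed.

(** * Poles and values of meromorphic maps *)

Lemma cvg_horner (K : numFieldType) (p : {poly K}) (x : K) :
  p.[y] @[y --> x] --> p.[x].
Proof.
have h (q : {poly K}) : continuous (horner q : K -> K).
  elim/poly_ind: q => [|q c ih].
    rewrite (_ : horner 0 = cst (0 : K) :> (K -> K)); first exact: cst_continuous.
    by apply/funext => y; rewrite horner0.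
  rewrite (_ : horner _ = ((horner q : K -> K) * id + cst c) :> (K -> K)); last first.
    by apply/funext => y; rewrite hornerMXaddC.
  move=> y; apply: continuousD; last exact: cst_continuous.
  by apply: continuousM; [exact: ih|move=> ?; exact: cvg_id].
exact: h.
Qed.

Lemma cvg_rational (K : numFieldType) (n q : {poly K}) (x : K) (g : K -> K) :
  q.[x] != 0 -> (forall y, y != x -> g y = n.[y] / q.[y]) ->
  g y @[y --> x^'] --> (n.[x] / q.[x]).
Proof.
move=> q0 gE.
have h : (n.[y] / q.[y]) @[y --> x^'] --> (n.[x] / q.[x]).
  apply: cvg_within_filter; apply: cvgM; first exact: cvg_horner.
  by apply: cvgV => //; exact: cvg_horner.
apply: cvg_trans h; apply: near_eq_cvg; near=> y.
by rewrite gE //; near: y; exact: nbhs_dnbhs_neq.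
Unshelve. all: by end_near. Qed.

(** The quotient [q / n] tends to 0, and it does not vanish on a punctured neighbourhood because a
    simple root is isolated; its inverse therefore exceeds every bound. *)
Lemma rational_blowup (K : numFieldType) (n q : {poly K}) (x : K) (g : K -> K) :
  q.[x] = 0 -> q^`().[x] != 0 -> n.[x] != 0 ->
  (forall y, y != x -> g y = n.[y] / q.[y]) ->
  forall M : K, M \is Num.real -> \forall y \near x^', M < `|g y|.
Proof.
move=> q0 q'0 n0 gE M Mr.
have /factor_theorem[r qE] : root q x by apply/rootP.
have r0 : r.[x] != 0.
  move: q'0; rewrite qE derivM derivXsubC mulr1 hornerD hornerM hornerXsubC subrr mulr0 add0r.
  by [].
have M1 : 0 < `|M| + 1 by rewrite ltr_wpDl.
have := cvgM (@cvg_horner K q x) (cvgV n0 (@cvg_horner K n x)).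
rewrite q0 mul0r => /(_ (nbhs_filter x) (nbhs_filter x)) h.
have e0 : 0 < (`|M| + 1)^-1 by rewrite invr_gt0.
have small := @cvgr0_norm_lt _ _ _ (nbhs x) _ _ h _ e0.
near=> y.
have yx : y != x by near: y; exact: nbhs_dnbhs_neq.
have ny : n.[y] != 0 by near: y; apply: nbhs_dnbhs; exact: cvgr_neq0 (@cvg_horner K n x) n0.
have ry : r.[y] != 0 by near: y; apply: nbhs_dnbhs; exact: cvgr_neq0 (@cvg_horner K r x) r0.
have qy : q.[y] != 0 by rewrite qE hornerM hornerXsubC mulf_neq0 // subr_eq0.
have hy : `|q.[y] / n.[y]| < (`|M| + 1)^-1.
  by near: y; apply: nbhs_dnbhs; exact: small.
rewrite gE // -[n.[y] / q.[y]]invf_div normfV.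
apply: (@lt_trans _ _ (`|M| + 1)).
  by apply: le_lt_trans (real_ler_norm Mr) _; rewrite ltrDl.
by rewrite -[X in X < _]invrK ltf_pV2 // posrE ?invr_gt0 // normr_gt0 mulf_neq0 ?invr_eq0.
Unshelve. all: by end_near. Qed.

Lemma rational_bounded (K : numFieldType) (x l : K) (g : K -> K) :
  g y @[y --> x^'] --> l -> ~ (\forall y \near x^', `|l| + 1 < `|g y|).
Proof.
move=> gl blow.
have small : \forall y \near x^', `|g y| < `|l| + 1.
  have l1 : `|l| < `|l| + 1 by rewrite ltrDl.
  exact: (@cvgr_norm_lt _ _ _ (x^') _ _ _ gl _ l1).
have /filter_ex[y [/lt_trans h /h]] : x^' (fun y => `|l| + 1 < `|g y| /\ `|g y| < `|l| + 1).
  exact: filterI.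
by rewrite ltxx.
Qed.

(** * Gluing the affine chart and the chart at infinity *)

(** All coordinates of the lift are Hermitian in [(N, q, m)], so a common factor [s] multiplies them
    by [|s|^2], which cancels in the projection. *)
Lemma nc_lift_scale (R : realType) (c c' : null_curve R) (s z z' : R[i]) : s != 0 ->
  (forall j, (nc_num c' j).[z'] = s * (nc_num c j).[z]) ->
  (ncq c').[z'] = s * (ncq c).[z] -> (ncm c').[z'] = s * (ncm c).[z] ->
  nc_lift c' z' = nc_lift c z.
Proof.
move=> s0 hn hq hm.
have h0 : (nc0 c').[z'] = s * (nc0 c).[z] := hn 0%N.
have h1 : (nc1 c').[z'] = s * (nc1 c).[z] := hn 1%N.
have h2 : (nc2 c').[z'] = s * (nc2 c).[z] := hn 2%N.
have ss0 : s * s^* != 0 by rewrite mulf_neq0 // conjc_eq0.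
have hg : weval (nc_g c') z' = s * s^* * weval (nc_g c) z.
  by rewrite !nc_gE h0 h1 h2 hq hm !rmorphM; field.
have hS : weval (nc_sum c') z' = s * s^* * weval (nc_sum c) z.
  by rewrite !nc_sumE hg hq !rmorphM /=; ring.
apply/rowP => j; rewrite !mxE !nc_lift_expE hS.
have -> : weval (nc_cone c' j) z' = s * s^* * weval (nc_cone c j) z.
  case: j => [[|[|[|[|//]]]] jl]; rewrite [nat_of_ord _]/=.
  - by rewrite /= h0 hq !rmorphM /=; ring.
  - by rewrite /= h1 hq !rmorphM /=; ring.
  - by rewrite /= h2 hq !rmorphM /=; ring.
  - by rewrite !nc_cone3E hg hq !rmorphM /=; ring.
by rewrite -mulf_div divff // mul1r.
Qed.

(** At a zero of [q] the vector of [nc_immersed] reduces to [- N q']. *)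
Lemma ncq_simple (R : realType) (c : null_curve R) z : (ncq c).[z] = 0 ->
  (ncq c)^`().[z] != 0 /\ exists j : 'I_3, (nc_num c j).[z] != 0.
Proof.
move=> q0; have := nc_immersed c z.
rewrite !hornerD !hornerN !hornerM q0 !mulr0 !sub0r !oppr_eq0 !mulf_eq0 !negb_or.
case/or3P => /andP[n0 q'0]; split=> //.
- by exists (@Ordinal 3%N 0%N isT).
- by exists (@Ordinal 3%N 1%N isT).
- by exists (@Ordinal 3%N 2%N isT).
Qed.

(* [c'] describes the curve of [c] in the coordinate 1/z. *)
Definition nc_reciprocal (R : realType) (d : nat) (c c' : null_curve R) : Prop :=
  [/\ forall j w, w != 0 -> (nc_num c' j).[w] = w ^+ d * (nc_num c j).[w^-1],
      forall w, w != 0 -> (ncq c').[w] = w ^+ d * (ncq c).[w^-1],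
      forall w, w != 0 -> (ncm c').[w] = w ^+ d * (ncm c).[w^-1] &
      (ncq c').[0] != 0].

Definition CP1_lift (R : realType) (c c' : null_curve R) (a : CP1 R) : 'rV[R]_4 :=
  match a with Some z => nc_lift c z | None => nc_lift c' 0 end.

Definition CP1_curve (R : realType) (c c' : null_curve R) (a : CP1 R) : 'rV[R]_3 :=
  match a with Some z => nc_curve c z | None => nc_curve c' 0 end.

Lemma CP1_chartE (R : realType) (u : 'rV[R]_2) (inf : bool) :
  CP1_chart inf u = if inf then (if plane_point u == 0 then None else Some (plane_point u)^-1)
                    else Some (plane_point u).
Proof. by []. Qed.

Lemma CP1_lift_chart (R : realType) (d : nat) (c c' : null_curve R) (inf : bool) u :
  nc_reciprocal d c c' ->
  CP1_lift c c' (CP1_chart inf u) = nc_lift (if inf then c' else c) (plane_point u).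
Proof.
move=> [hn hq hm _]; rewrite CP1_chartE; case: inf => //.
have [-> //|z0] := eqVneq (plane_point u) 0.
apply/esym/(@nc_lift_scale _ _ _ (plane_point u ^+ d)).
- by rewrite expf_neq0.
- by move=> j; rewrite hn.
- by rewrite hq.
- by rewrite hm.
Qed.

Lemma CP1_curve_chart (R : realType) (d : nat) (c c' : null_curve R) (inf : bool) u :
  nc_reciprocal d c c' ->
  CP1_curve c c' (CP1_chart inf u) = nc_curve (if inf then c' else c) (plane_point u).
Proof.
move=> [hn hq hm _]; rewrite CP1_chartE; case: inf => //.
have [-> //|z0] := eqVneq (plane_point u) 0.
apply/rowP => j; rewrite !mxE hn // hq // -mulf_div divff ?mul1r //.
by rewrite expf_neq0.
Qed.

(** Infinity is not an end, in accordance with the last clause of [nc_reciprocal]. *)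
Definition nc_ends (R : realType) (c : null_curve R) : set (CP1 R) :=
  [set a | if a is Some z then (ncq c).[z] == 0 else false].

Lemma nc_ends_chart (R : realType) (d : nat) (c c' : null_curve R) (inf : bool) :
  nc_reciprocal d c c' ->
  @CP1_chart R inf @^-1` (~` nc_ends c) =
  [set u | (ncq (if inf then c' else c)).[plane_point u] != 0].
Proof.
move=> [_ hq _ q0]; apply/seteqP; split=> u; rewrite /= CP1_chartE; case: inf.
- have [-> //|z0] := eqVneq (plane_point u) 0.
  by rewrite hq // mulf_eq0 (negbTE (expf_neq0 _ z0)) => /negP.
- by move=> /negP.
- have [-> //|z0] := eqVneq (plane_point u) 0.
  by rewrite hq // mulf_eq0 (negbTE (expf_neq0 _ z0)) => /negP.
- by move=> /negP.
Qed.

Lemma planar_ends_CP1 (R : realType) (d : nat) (c c' : null_curve R)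
    (f : CP1 R -> 'rV[R]_3) :
  nc_reciprocal d c c' ->
  (forall a, ~ nc_ends c a -> f a = CP1_curve c c' a) ->
  minimal_surface_planar_ends (nc_ends c) f.
Proof.
move=> rec fE.
exists (CP1_lift c c'), (north_pole R), (equator_frame R); split.
- by case=> [z|]; exact: sphere3_nc_lift.
- move=> inf; rewrite preimage_setT.
  by apply: conformal_nc_lift => u; exact: CP1_lift_chart rec.
- by split; [exact: sphere3_north_pole|exact: stereo_frame_equator].
- apply/seteqP; split; case=> [z|] /=.
  + by move/nc_lift_north_pole => ->.
  + by move/nc_lift_north_pole => q0; case: rec => _ _ _; rewrite q0 eqxx.
  + by move/eqP => q0; apply/nc_lift_north_pole.
  + by [].
- split.
    case=> [z|] /= aE; rewrite fE //= stereo_nc_lift //; first exact/negP.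
    by case: rec.
  have minimal inf := @minimal_nc_curve R (if inf then c' else c)
    (@CP1_chart R inf @^-1` (~` nc_ends c)) (f \o @CP1_chart R inf) (nc_ends_chart inf rec).
  have fE' inf u : (@CP1_chart R inf @^-1` (~` nc_ends c)) u ->
      (f \o @CP1_chart R inf) u = nc_curve (if inf then c' else c) (plane_point u).
    by move=> Uu; rewrite /= fE // (CP1_curve_chart inf u rec).
  split; first by move=> inf; have [] := minimal inf (fE' inf).
  by move=> inf u; have [_] := minimal inf (fE' inf); apply.
Qed.

(** * Poles and real part of a map given by a null curve *)

Section MeromorphicMap.
Variables (R : realType) (d : nat) (c c' : null_curve R) (F : R[i] -> 'rV[R[i]]_3).
Hypothesis rec : nc_reciprocal d c c'.
Hypothesis FE : forall z j, F z 0 j = (nc_num c j).[z] / (ncq c).[z].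

Let FE' (w : R[i]) j : w != 0 -> F w^-1 0 j = (nc_num c' j).[w] / (ncq c').[w].
Proof.
move=> w0; case: rec => hn hq _ _.
by rewrite FE hn // hq // -mulf_div divff ?mul1r // expf_neq0.
Qed.

Lemma cvg_mero (a : CP1 R) (j : 'I_3) : ~ nc_ends c a ->
  (F z 0 j : R[i]^o) @[z --> CP1_dnbhs a] -->
   (match a with Some z => (nc_num c j).[z] / (ncq c).[z]
               | None => (nc_num c' j).[0] / (ncq c').[0] end : R[i]^o).
Proof.
case: a => [z /negP q0|_].
  by apply: (@cvg_rational R[i] (nc_num c j) (ncq c) z (fun y => F y 0 j)) => // y _; exact: FE.
apply: (@cvg_rational R[i] (nc_num c' j) (ncq c') 0 (fun w => F w^-1 0 j)).
  by case: rec.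
by move=> y y0; exact: FE'.
Qed.

(** Off the zeros of [q], and at infinity, every component has a finite limit. At a zero of [q],
    which is simple, some numerator does not vanish and that component blows up. *)
Lemma poles_mero : poles F = nc_ends c.
Proof.
apply/seteqP; split=> a.
  move=> [j pole]; apply: contrapT => aE.
  have cv := cvg_mero (j := j) aE.
  set l := (X in _ --> X) in cv.
  (* The bound in [is_pole] is a real number, whereas [|l| + 1] is a complex one that happens to be
     real. *)
  have lr : (Re (`|l| + 1))%:C = `|l| + 1.
    by apply: RRe_real; rewrite realD ?normr_real ?real1.
  have := pole (Re (`|l| + 1)); rewrite lr.
  case: a {aE pole} @l cv lr => [z|] l cv lr.
    exact: (@rational_bounded R[i] z l (fun y => F y 0 j) cv).
  exact: (@rational_bounded R[i] 0 l (fun w => F w^-1 0 j) cv).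
case: a => [z /= /eqP q0|//].
have [q'0 [j n0]] := ncq_simple q0.
exists j => M; apply: (@rational_blowup R[i] (nc_num c j) (ncq c) z (fun y => F y 0 j)) => //.
by rewrite complex_real.
Qed.

Lemma mero_Re_curve (a : CP1 R) : ~ nc_ends c a -> mero_Re F a = CP1_curve c c' a.
Proof.
move=> aE; apply/rowP => j; rewrite mxE /mero_value.
have cv := cvg_mero (j := j) aE.
case: a aE cv => [z|] aE cv; rewrite mxE; congr (Re _).
  exact: (@cvg_lim R[i]^o (@norm_hausdorff _ R[i]^o) _ _ (Proper_dnbhs_regular_numFieldType (z : R[i]^o)) _ _ cv).
exact: (@cvg_lim R[i]^o (@norm_hausdorff _ R[i]^o) _ _
  (fmap_proper_filter _ (Proper_dnbhs_regular_numFieldType (0 : R[i]^o))) _ _ cv).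
Qed.

Lemma planar_ends_mero : minimal_surface_planar_ends (poles F) (mero_Re F).
Proof. by rewrite poles_mero; apply: planar_ends_CP1 rec mero_Re_curve. Qed.

End MeromorphicMap.

(** * Counting simple roots *)

Lemma card_simple_roots (F : closedFieldType) (p : {poly F}) (n : nat) :
  (forall z, p.[z] = 0 -> p^`().[z] != 0) -> size p = n.+1 ->
  ([set z | p.[z] == 0] #= `I_n)%card.
Proof.
move=> simple sp.
have p0 : p != 0 by rewrite -size_poly_eq0 sp.
have [r pE] := closed_field_poly_normal p.
have lp : lead_coef p != 0 by rewrite lead_coef_eq0.
have ur : uniq r.
  (* If [x] occurred twice, the product over the remaining roots would vanish at [x], and so would
     the derivative of [p]. *)
  apply: count_mem_uniq => x; case: (boolP (x \in r)) => [xr|/count_memPn //].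
  have permr := perm_to_rem xr.
  have pE' : p = lead_coef p *: (('X - x%:P) * \prod_(z <- rem x r) ('X - z%:P)).
    by rewrite {1}pE (perm_big _ permr) big_cons.
  have x0 : p.[x] = 0 by rewrite pE' hornerZ hornerM hornerXsubC subrr mul0r mulr0.
  have := simple x x0; rewrite pE' derivZ derivM derivXsubC mul1r !hornerE subrr mul0r addr0.
  rewrite mulf_eq0 negb_or => /andP[_]; rewrite -/(root _ x) root_prod_XsubC => nx.
  by rewrite (permP permr) /= eqxx (count_memPn nx).
have rE z : (p.[z] == 0) = (z \in r).
  by rewrite -root_prod_XsubC {1}pE hornerZ mulf_eq0 (negbTE lp).
have -> : [set z | p.[z] == 0] = [set` [fset z | z in r]%fset].
  by apply/seteqP; split=> z /=; rewrite rE in_fset.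
apply/card_eq_fsetP; rewrite card_fseq undup_id //.
by move: sp; rewrite {1}pE size_scale // size_prod_XsubC => -[].
Qed.

(** * The curve of the theorem, with k = j + 4 *)

Lemma deriv_polyCM (F : nzRingType) (a : F) (p : {poly F}) :
  (a%:P * p)^`() = a%:P * p^`().
Proof. by rewrite !mul_polyC derivZ. Qed.

Section Curve.
Variables (R : realType) (j : nat).
Let C := R[i].
Let k : C := (j.+4)%:R.
(** The polynomial D is [cA - cB z^k - cC z^(2k)]. The numerator of the second component is [k - 1]
    times [e + a z^k + b z^(2k) - g z^4], and [c0] is the constant of the first one without its
    factor i. The value of [m] is the one for which N . N = q m. *)
Let cA : C := (k - 3) * (k - 1) ^+ 2 * (2 * k - 3).
Let cB : C := 6 * (k - 1) * (2 * k - 3).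
Let cC : C := 3 * (k - 3).
Let a : C := - 12 * (3 - 2 * k) ^+ 2 * (k - 2).
Let b : C := - 12 * (k - 3) * (2 * k - 3).
Let e : C := (k - 3) * (6 - 7 * k + 2 * k ^+ 2) ^+ 2.
Let g : C := 12 * (k - 3).
Let c0 : C := - 12 * (k - 3) * (2 * k - 3).
Let m : C := - 48 * (k - 3) * (2 * k - 3) * (k - 2) ^+ 2.

Definition affine_num0 : {poly R[i]} := 'i%:P *
  ((c0 * (2 - 3 * k + k ^+ 2))%:P * 'X^2 - (2 * c0)%:P * 'X^(j.+4.+2)).
Definition affine_num1 : {poly R[i]} :=
  ((k - 1) * a)%:P * 'X^(j.+4) + ((k - 1) * b)%:P * 'X^((j + j).+4.+4)
  + ((k - 1) * e)%:P - ((k - 1) * g)%:P * 'X^4.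
(* The third numerator divided by i: [N_2 - i N_3] is [affine_num1 + affine_num2i]. *)
Definition affine_num2i : {poly R[i]} :=
  - (((k - 1) * a)%:P * 'X^(j.+4)) - ((k - 1) * b)%:P * 'X^((j + j).+4.+4)
  - ((k - 1) * e)%:P - ((k - 1) * g)%:P * 'X^4.
Definition affine_den : {poly R[i]} :=
  (4 * cA)%:P * 'X - (4 * cB)%:P * 'X^(j.+4.+1) - (4 * cC)%:P * 'X^((j + j).+4.+4.+1).
Definition affine_aux : {poly R[i]} := m%:P * 'X^3.

(** Exponents are complemented to [2k + 1], the degree of [affine_den]; hence [infty_den] has a
    nonzero constant term. *)
Definition infty_num0 : {poly R[i]} := 'i%:P *
  ((c0 * (2 - 3 * k + k ^+ 2))%:P * 'X^((j + j).+4.+3) - (2 * c0)%:P * 'X^(j.+3)).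
Definition infty_num1 : {poly R[i]} :=
  ((k - 1) * a)%:P * 'X^(j.+4.+1) + ((k - 1) * b)%:P * 'X
  + ((k - 1) * e)%:P * 'X^((j + j).+4.+4.+1) - ((k - 1) * g)%:P * 'X^((j + j).+4.+1).
Definition infty_num2i : {poly R[i]} :=
  - (((k - 1) * a)%:P * 'X^(j.+4.+1)) - ((k - 1) * b)%:P * 'X
  - ((k - 1) * e)%:P * 'X^((j + j).+4.+4.+1) - ((k - 1) * g)%:P * 'X^((j + j).+4.+1).
Definition infty_den : {poly R[i]} :=
  (4 * cA)%:P * 'X^((j + j).+4.+4) - (4 * cB)%:P * 'X^(j.+4) - (4 * cC)%:P.
Definition infty_aux : {poly R[i]} := m%:P * 'X^((j + j).+4.+2).

Lemma polyi_sqr : ('i%:P : {poly R[i]}) ^+ 2 = -1.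
Proof. by rewrite -polyC_exp sqr_i polyCN. Qed.

Lemma affine_null : affine_num0 ^+ 2 + affine_num1 ^+ 2 + ('i%:P * affine_num2i) ^+ 2 = affine_den * affine_aux.
Proof.
(* Splitting the exponents leaves ['X^j] as a free symbol, so that [ring] proves the identity for
   all [j] at once. *)
rewrite /affine_num0 !exprMn polyi_sqr /affine_num1 /affine_num2i /affine_den /affine_aux !exprS !exprD expr0.
rewrite /m /c0 /g /e /a /b /cA /cB /cC.
ring.
Qed.

Lemma affine_null_deriv : affine_num0^`() ^+ 2 + affine_num1^`() ^+ 2 + ('i%:P * affine_num2i)^`() ^+ 2
  = affine_den^`() * affine_aux^`().
Proof.
rewrite /affine_num0 !deriv_polyCM !exprMn polyi_sqr /affine_num1 /affine_num2i /affine_den /affine_aux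
  !(deriv_polyCM, derivB, derivD, derivN, derivC, derivXn, derivX) !succnK.
rewrite !exprS !exprD expr0.
(* Differentiation brings down exponents as multiples depending on [j], so [k] is unfolded to match
   them. *)
rewrite /m /c0 /g /e /a /b /cA /cB /cC /k.
ring.
Qed.

Lemma infty_null : infty_num0 ^+ 2 + infty_num1 ^+ 2 + ('i%:P * infty_num2i) ^+ 2 = infty_den * infty_aux.
Proof.
rewrite /infty_num0 !exprMn polyi_sqr /infty_num1 /infty_num2i /infty_den /infty_aux !exprS !exprD expr0.
rewrite /m /c0 /g /e /a /b /cA /cB /cC.
ring.
Qed.

Lemma infty_null_deriv : infty_num0^`() ^+ 2 + infty_num1^`() ^+ 2 + ('i%:P * infty_num2i)^`() ^+ 2
  = infty_den^`() * infty_aux^`().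
Proof.
rewrite /infty_num0 !deriv_polyCM !exprMn polyi_sqr /infty_num1 /infty_num2i /infty_den /infty_aux
  !(deriv_polyCM, derivB, derivD, derivN, derivC, derivXn, derivX) !succnK.
rewrite !exprS !exprD expr0.
rewrite /m /c0 /g /e /a /b /cA /cB /cC /k.
ring.
Qed.

(** * Wronskians of the curve and immersion *)

Let k1 : k - 1 != 0.
Proof. by have -> : k - 1 = (j.+3)%:R; [rewrite /k; ring|rewrite pnatr_eq0]. Qed.
Let k2 : k - 2 != 0.
Proof. by have -> : k - 2 = (j.+2)%:R; [rewrite /k; ring|rewrite pnatr_eq0]. Qed.
Let k3 : k - 3 != 0.
Proof. by have -> : k - 3 = (j.+1)%:R; [rewrite /k; ring|rewrite pnatr_eq0]. Qed.
Let k23 : 2 * k - 3 != 0.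
Proof. by have -> : 2 * k - 3 = (j.*2.+4.+1)%:R; [rewrite /k -muln2; ring|rewrite pnatr_eq0]. Qed.

(** The combination [N_2 - i N_3] is the monomial [- 2 (k - 1) g z^4], so its Wronskian with [4 z D]
    is a multiple of [z^4 (3 D - z D')], and [3 D - z D'] is a constant times a perfect square. *)
Lemma affine_wronskian_minus z :
  (affine_num1^`() * affine_den - affine_num1 * affine_den^`()).[z]
  + (affine_num2i^`() * affine_den - affine_num2i * affine_den^`()).[z] =
  - 288 * (k - 1) * (k - 3) ^+ 2 * (2 * k - 3) * z ^+ 4 * (z ^+ j.+4 + (k - 1)) ^+ 2.
Proof.
rewrite /affine_num1 /affine_num2i /affine_den
  !(deriv_polyCM, derivB, derivD, derivN, derivC, derivXn, derivX) !succnK.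
rewrite
  !(hornerXn, hornerX, hornerC, hornerMn, hornerD, hornerN, hornerM).
rewrite !exprS !exprD expr0 /g /e /a /b /cA /cB /cC /k.
ring.
Qed.

Lemma affine_wronskian_plus z : z ^+ j.+4 = - (k - 1) ->
  (affine_num1^`() * affine_den - affine_num1 * affine_den^`()).[z]
  - (affine_num2i^`() * affine_den - affine_num2i * affine_den^`()).[z] =
  - 128 * k ^+ 4 * (k - 1) ^+ 3 * (k - 2) ^+ 2 * (2 * k - 3).
Proof.
move=> zk.
(* In terms of [u = z^k] the denominator is [4 z Q(u)] and [N_2 + i N_3] is [2 (k - 1) E(u)]; their
   Wronskian depends on [u] only. *)
pose Q u := cA - cB * u - cC * u ^+ 2.
pose E u := e + a * u + b * u ^+ 2.
transitivity (8 * (k - 1) * ((k * a * (z ^+ j.+4) + 2 * k * b * (z ^+ j.+4) ^+ 2) * Q (z ^+ j.+4)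
  - E (z ^+ j.+4) * (Q (z ^+ j.+4) - k * cB * (z ^+ j.+4) - 2 * k * cC * (z ^+ j.+4) ^+ 2))).
  rewrite /affine_num1 /affine_num2i /affine_den
  !(deriv_polyCM, derivB, derivD, derivN, derivC, derivXn, derivX) !succnK.
  rewrite
  !(hornerXn, hornerX, hornerC, hornerMn, hornerD, hornerN, hornerM).
  rewrite /Q /E !exprS !exprD expr0 /g /e /a /b /cA /cB /cC /k.
  ring.
rewrite zk /Q /E /e /a /b /cA /cB /cC; ring.
Qed.

Lemma affine_wronskian0 :
  (affine_num1^`() * affine_den - affine_num1 * affine_den^`()).[0] =
  - 4 * (k - 3) ^+ 2 * (k - 1) ^+ 3 * (2 * k - 3) ^+ 3 * (k - 2) ^+ 2.
Proof.
rewrite /affine_num1 /affine_den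
  !(deriv_polyCM, derivB, derivD, derivN, derivC, derivXn, derivX) !succnK.
rewrite
  !(hornerXn, hornerX, hornerC, hornerMn, hornerD, hornerN, hornerM).
rewrite !exprS !exprD expr0 /g /e /a /b /cA /cB /cC.
ring.
Qed.

(** In the coordinate [w = 1 / z] a Wronskian becomes [- w^(4k)] times its value at [1 / w], the
    degree being [2k + 1]; so the factor [z^4 (z^k + k - 1)^2] turns into
    [w^(2k-4) ((k - 1) w^k + 1)^2]. *)
Lemma infty_wronskian_minus z :
  (infty_num1^`() * infty_den - infty_num1 * infty_den^`()).[z]
  + (infty_num2i^`() * infty_den - infty_num2i * infty_den^`()).[z] =
  288 * (k - 1) * (k - 3) ^+ 2 * (2 * k - 3) * z ^+ ((j + j).+4) * ((k - 1) * z ^+ j.+4 + 1) ^+ 2.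
Proof.
rewrite /infty_num1 /infty_num2i /infty_den
  !(deriv_polyCM, derivB, derivD, derivN, derivC, derivXn, derivX) !succnK.
rewrite
  !(hornerXn, hornerX, hornerC, hornerMn, hornerD, hornerN, hornerM).
rewrite !exprS !exprD expr0 /g /e /a /b /cA /cB /cC /k.
ring.
Qed.

Lemma infty_wronskian_plus z : z ^+ j.+4 = - (k - 1)^-1 ->
  (infty_num1^`() * infty_den - infty_num1 * infty_den^`()).[z]
  - (infty_num2i^`() * infty_den - infty_num2i * infty_den^`()).[z] =
  128 * k ^+ 4 * (k - 1)^-1 * (k - 2) ^+ 2 * (2 * k - 3).
Proof.
move=> zk.
pose Q u := cA * u ^+ 2 - cB * u - cC.
pose E u := e * u ^+ 2 + a * u + b.
transitivity (8 * (k - 1) * ((E (z ^+ j.+4) + k * a * (z ^+ j.+4) + 2 * k * e * (z ^+ j.+4) ^+ 2) * Q (z ^+ j.+4)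
  - E (z ^+ j.+4) * (2 * k * cA * (z ^+ j.+4) ^+ 2 - k * cB * (z ^+ j.+4)))).
  rewrite /infty_num1 /infty_num2i /infty_den
  !(deriv_polyCM, derivB, derivD, derivN, derivC, derivXn, derivX) !succnK.
  rewrite
  !(hornerXn, hornerX, hornerC, hornerMn, hornerD, hornerN, hornerM).
  rewrite /Q /E !exprS !exprD expr0 /g /e /a /b /cA /cB /cC /k.
  ring.
rewrite zk /Q /E /e /a /b /cA /cB /cC; field.
by rewrite (_ : 4 + j%:R - 1 = k - 1) ?k1 //; rewrite /k; ring.
Qed.

Lemma infty_wronskian0 :
  (infty_num1^`() * infty_den - infty_num1 * infty_den^`()).[0] =
  144 * (k - 1) * (k - 3) ^+ 2 * (2 * k - 3).
Proof.
rewrite /infty_num1 /infty_den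
  !(deriv_polyCM, derivB, derivD, derivN, derivC, derivXn, derivX) !succnK.
rewrite
  !(hornerXn, hornerX, hornerC, hornerMn, hornerD, hornerN, hornerM).
rewrite !exprS !exprD expr0 /g /e /a /b /cA /cB /cC.
ring.
Qed.

Lemma wronskian_i (p q : {poly R[i]}) z :
  ((('i%:P * p)^`() * q - ('i%:P * p) * q^`()).[z] == 0) =
  ((p^`() * q - p * q^`()).[z] == 0).
Proof.
have -> : ('i%:P * p)^`() * q - ('i%:P * p) * q^`() = 'i%:P * (p^`() * q - p * q^`()).
  by rewrite deriv_polyCM; ring.
by rewrite hornerM hornerC mulf_eq0 eq_complex /= oner_eq0 andbF.
Qed.

(** If the second and third components vanish, so do the combinations for [N_2 - i N_3] and
    [N_2 + i N_3]. The former leaves only [z = 0] and [z^k = 1 - k], excluded by [affine_wronskian0]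
    and [affine_wronskian_plus]. *)
Lemma affine_immersed z :
  [|| (affine_num0^`() * affine_den - affine_num0 * affine_den^`()).[z] != 0,
      (affine_num1^`() * affine_den - affine_num1 * affine_den^`()).[z] != 0
    | (('i%:P * affine_num2i)^`() * affine_den - 'i%:P * affine_num2i * affine_den^`()).[z] != 0].
Proof.
rewrite wronskian_i -!negb_and; apply/negP => /and3P[_ /eqP w1 /eqP w2].
have := affine_wronskian_minus z; rewrite w1 w2 addr0 => /esym/eqP.
rewrite !(oppr_eq0, pnatr_eq0, invr_eq0, expf_eq0, mulf_eq0) (negbTE k1) (negbTE k3) (negbTE k23) /=.
case/orP => [/eqP z0|].
  have := affine_wronskian0; rewrite -z0 w1 => /esym/eqP.
  by rewrite !(oppr_eq0, pnatr_eq0, invr_eq0, expf_eq0, mulf_eq0) (negbTE k1) (negbTE k2) (negbTE k3) (negbTE k23).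
rewrite addr_eq0 => /eqP zk.
have := affine_wronskian_plus zk; rewrite w1 w2 subr0 => /esym/eqP.
by rewrite !(oppr_eq0, pnatr_eq0, invr_eq0, expf_eq0, mulf_eq0) (negbTE k1) (negbTE k2) (negbTE k23).
Qed.

Lemma infty_immersed z :
  [|| (infty_num0^`() * infty_den - infty_num0 * infty_den^`()).[z] != 0,
      (infty_num1^`() * infty_den - infty_num1 * infty_den^`()).[z] != 0
    | (('i%:P * infty_num2i)^`() * infty_den - 'i%:P * infty_num2i * infty_den^`()).[z] != 0].
Proof.
rewrite wronskian_i -!negb_and; apply/negP => /and3P[_ /eqP w1 /eqP w2].
have := infty_wronskian_minus z; rewrite w1 w2 addr0 => /esym/eqP.
rewrite !(oppr_eq0, pnatr_eq0, invr_eq0, expf_eq0, mulf_eq0) (negbTE k1) (negbTE k3) (negbTE k23) /=.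
case/orP => [/eqP z0|].
  have := infty_wronskian0; rewrite -z0 w1 => /esym/eqP.
  by rewrite !(oppr_eq0, pnatr_eq0, invr_eq0, expf_eq0, mulf_eq0) (negbTE k1) (negbTE k3) (negbTE k23).
rewrite addr_eq0 => /eqP zk.
have zk' : z ^+ j.+4 = - (k - 1)^-1.
  by apply: (mulfI k1); rewrite zk mulrN divff.
have := infty_wronskian_plus zk'; rewrite w1 w2 subr0 => /esym/eqP.
by rewrite !(oppr_eq0, pnatr_eq0, invr_eq0, expf_eq0, mulf_eq0) (negbTE k1) (negbTE k2) (negbTE k23).
Qed.

Definition affine_curve := NullCurve affine_null affine_null_deriv affine_immersed.

Definition infty_curve := NullCurve infty_null infty_null_deriv infty_immersed.

(** * Identification with F and the number of ends *)

Lemma curve_reciprocal : nc_reciprocal ((j + j).+4.+4.+1) affine_curve infty_curve.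
Proof.
split.
- move=> l w w0; case: l => [|[|[|l]]]; rewrite /nc_num /=.
  + rewrite /infty_num0 /affine_num0
  !(hornerXn, hornerX, hornerC, hornerD, hornerN, hornerM) !exprVn.
    have t0 : w ^+ j != 0 by rewrite expf_neq0.
    by rewrite !exprS !exprD ?expr0; field; rewrite w0 ?t0.
  + rewrite /infty_num1 /affine_num1
  !(hornerXn, hornerX, hornerC, hornerD, hornerN, hornerM) !exprVn.
    have t0 : w ^+ j != 0 by rewrite expf_neq0.
    by rewrite !exprS !exprD ?expr0; field; rewrite w0 ?t0.
  + rewrite /infty_num2i /affine_num2i
  !(hornerXn, hornerX, hornerC, hornerD, hornerN, hornerM) !exprVn.
    have t0 : w ^+ j != 0 by rewrite expf_neq0.
    by rewrite !exprS !exprD ?expr0; field; rewrite w0 ?t0.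
  + by rewrite nth_nil !horner0 mulr0.
- move=> w w0; rewrite /= /infty_den /affine_den
  !(hornerXn, hornerX, hornerC, hornerD, hornerN, hornerM) !exprVn.
  have t0 : w ^+ j != 0 by rewrite expf_neq0.
  by rewrite !exprS !exprD ?expr0; field; rewrite w0 ?t0.
- move=> w w0; rewrite /= /infty_aux /affine_aux
  !(hornerXn, hornerX, hornerC, hornerD, hornerN, hornerM) !exprVn.
  have t0 : w ^+ j != 0 by rewrite expf_neq0.
  by rewrite !exprS !exprD ?expr0; field; rewrite w0 ?t0.
- rewrite /= /infty_den
  !(hornerXn, hornerX, hornerC, hornerD, hornerN, hornerM) !expr0n /= !mulr0 subr0 add0r.
  by rewrite oppr_eq0 !mulf_neq0 ?pnatr_eq0.
Qed.

(** Numerators and denominators agree separately, so the equality also holds at the zeros of the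
    denominator. *)
Lemma mapF_curve z (l : 'I_3) : mapF j.+4 z 0 l = (nc_num affine_curve l).[z] / (ncq affine_curve).[z].
Proof.
have e2 : (2 * j.+4 = (j + j).+4.+4)%N by lia.
have -> : (ncq affine_curve).[z] = 4 * z * polyD j.+4 z.
  rewrite /polyD e2 /= /affine_den
  !(hornerXn, hornerX, hornerC, hornerD, hornerN, hornerM).
  by rewrite /cA /cB /cC /k !exprS !exprD expr0; ring.
rewrite mxE; case: l => [[|[|[|//]]] ?] /=; rewrite /mapF1 /mapF2 /mapF3 ?e2 /nc_num /=;
  congr (_ / _).
- rewrite /affine_num0
  !(hornerXn, hornerX, hornerC, hornerD, hornerN, hornerM) /c0 /k !exprS expr0.
  by ring.
- rewrite /affine_num1
  !(hornerXn, hornerX, hornerC, hornerD, hornerN, hornerM) /a /b /e /g /k.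
  by rewrite !exprS !exprD expr0; ring.
- rewrite /affine_num2i
  !(hornerXn, hornerX, hornerC, hornerD, hornerN, hornerM) /a /b /e /g /k.
  by rewrite !exprS !exprD expr0; ring.
Qed.

Lemma size_affine_den : size affine_den = (2 * j.+4 + 2)%N.
Proof.
(* The leading coefficient, nonzero because [k] differs from 3; the degree is [2k + 1], one less
   than the size. *)
have c4 : - (4 * cC) != 0 by rewrite oppr_eq0 !mulf_neq0 ?pnatr_eq0.
have -> : affine_den = (- (4 * cC)) *: 'X^((j + j).+4.+4.+1)
    + ((4 * cA) *: 'X - (4 * cB) *: 'X^(j.+4.+1)).
  by rewrite /affine_den -!mul_polyC polyCN; ring.
rewrite size_polyDl size_scale // size_polyXn; first by lia.
rewrite (leq_ltn_trans (size_polyD _ _)) // gtn_max size_polyN.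
by rewrite !(leq_ltn_trans (size_scale_leq _ _)) ?size_polyX ?size_polyXn //; lia.
Qed.

End Curve.

Lemma card_affine_ends (R : realType) (j : nat) :
  (nc_ends (affine_curve R j) #= `I_(2 * j.+4 + 1)%N)%card.
Proof.
have -> : nc_ends (affine_curve R j) = Some @` [set z | (ncq (affine_curve R j)).[z] == 0].
  apply/seteqP; split=> [[z|//] q0|_ [z q0 <-] //].
  by exists z.
rewrite (card_eql card_some); apply: card_simple_roots.
  by move=> z /ncq_simple[].
by rewrite size_affine_den; lia.
Qed.

Local Close Scope complex_scope.
Local Close Scope ring_scope.
Local Close Scope classical_set_scope.

Theorem mainTheorem2 (R : realType) (k : nat) (hk : (4 <= k)%N) :
  minimal_surface_planar_ends (poles (@mapF R k)) (mero_Re (@mapF R k)) /\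
  (poles (@mapF R k) #= `I_(2 * k + 1))%card.
Proof.
(* With [k = j + 4] the exponents become explicit successors and [k - 1], [k - 2], [k - 3] are
   visibly nonzero. *)
have [j ->] : exists j, k = j.+4 by exists (k - 4)%N; lia.
have rec := curve_reciprocal R j; have FE := @mapF_curve R j.
split; first exact: planar_ends_mero rec FE.
by rewrite (poles_mero rec FE); exact: card_affine_ends.
Qed.
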